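(* Let $K$ be a (computable) perfect field, let $\mathcal{O}=\{1,y,x,y^2,x^2\}$ be the L-shape order ideal, and let $B_{\mathcal{O}}=K[C]/I(\mathbb{B}_{\mathcal{O}})$ be the coordinate ring of the L-shape border basis scheme. Let $Z$, $f_1,f_2\in K[C\setminus Z]$ and the isomorphism $\Phi:B_{\mathcal{O}}\to K[C\setminus Z]/\langle f_1,f_2\rangle$ be as given in the context. Define a $K$-algebra homomorphism $\psi:K[C\setminus Z]\to K[C\setminus Z]$ by $$\begin{aligned}\psi(c_{21})={}&-c_{41}^2c_{43}c_{51}^2-c_{41}c_{45}c_{51}^3+c_{41}^2c_{42}c_{51}+c_{41}^3c_{52}+c_{41}^2c_{51}c_{54}-c_{45}c_{51}^2\\&+c_{41}c_{51}c_{55}+c_{41}c_{42}-c_{41}c_{54}-c_{21}+c_{43},\\ \psi(c_{22})={}&2c_{33}c_{41}c_{51}+2c_{35}c_{51}^2+2c_{22}-c_{33},\\ \psi(c_{33})={}&c_{33}c_{41}c_{51}+c_{35}c_{51}^2+c_{22},\\ \psi(c_{42})={}&c_{41}^2c_{43}c_{51}^3+c_{41}c_{45}c_{51}^4-c_{41}^2c_{42}c_{51}^2-c_{41}^3c_{51}c_{52}-c_{41}^2c_{51}^2c_{54}+c_{45}c_{51}^3\\&-c_{41}c_{51}^2c_{55}-c_{41}c_{42}c_{51}+c_{41}c_{51}c_{54}+c_{21}c_{51}-c_{43}c_{51}-c_{42},\end{aligned}$$ and $\psi(c_{ij})=c_{ij}$ for the remaining indeterminates in $C\setminus Z$. Then: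 (1) $\psi$ is an isomorphism, and hence induces a $K$-algebra isomorphism $\Psi:K[C\setminus Z]/\langle f_1,f_2\rangle\to K[C\setminus Z]/\langle\psi(f_1),\psi(f_2)\rangle$. Moreover, $\psi(f_1)=-c_{21}$, and $(\psi(f_1),\psi(f_2))$ is $(c_{21},c_{22})$-separating. (2) Let $\hat f_1=c_{21}$ and let $\hat f_2$ be obtained from $\psi(f_2)$ by substituting $c_{21}\mapsto 0$. Then $\langle\psi(f_1),\psi(f_2)\rangle=\langle\hat f_1,\hat f_2\rangle$, and the coherently $(c_{21},c_{22})$-separating tuple $(\hat f_1,\hat f_2)$ yields a separating re-embedding $$\Theta:\ K[C\setminus Z]/\langle\hat f_1,\hat f_2\rangle\longrightarrow K[\widehat C],\qquad \widehat C=(c_{33},c_{35},c_{41},c_{42},c_{43},c_{45},c_{51},c_{52},c_{54},c_{55}).$$ (3) Altogether, $\Theta\circ\Psi\circ\Phi:B_{\mathcal{O}}\to K[\widehat C]$ is a $K$-algebra isomorphism; hence the L-shape border basis scheme is isomorphic to the affine space $\mathbb{A}^{10}$.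
   Context: Let $P=K[x,y]$, $x_1=x$, $x_2=y$, $\mathcal{O}=\{t_1,\dots,t_5\}$ with $t_1=1,t_2=y,t_3=x,t_4=y^2,t_5=x^2$, and border $\partial\mathcal{O}=\{b_1,\dots,b_5\}$ with $b_1=xy,b_2=y^3,b_3=xy^2,b_4=x^2y,b_5=x^3$. Let $C=(c_{11},\dots,c_{55})$ be 25 indeterminates. The generic multiplication matrix $\mathcal{A}_r\in\mathrm{Mat}_5(K[C])$ has $(i,j)$ entry $\delta_{im}$ if $x_rt_j=t_m$ and $c_{im}$ if $x_rt_j=b_m$. $I(\mathbb{B}_{\mathcal{O}})$ is generated by the entries of $\mathcal{A}_1\mathcal{A}_2-\mathcal{A}_2\mathcal{A}_1$; the L-shape border basis scheme is $\mathbb{B}_{\mathcal{O}}=\mathrm{Spec}(B_{\mathcal{O}})$ with $B_{\mathcal{O}}=K[C]/I(\mathbb{B}_{\mathcal{O}})$. A tuple $(p_1,\dots,p_s)$ of polynomials is $(z_1,\dots,z_s)$-separating, for distinct indeterminates $z_i$, if there is a term ordering $\sigma$ with $\mathrm{LT}_\sigma(p_i)=z_i$ for all $i$; it is coherently separating if $p_i=z_i-h_i$ and no $z_j$ divides a term in the support of any $h_i$. Given an ideal $I$ containing a coherently separating tuple $(z_i-h_i)_i$, the separating re-embedding is the isomorphism from the residue class ring modulo $I$ to the residue class ring of the polynomial ring in the remaining indeterminates modulo the elimination ideal, given by $z_i\mapsto h_i$ and the identity on the remaining indeterminates. Let $Z=(c_{11},c_{12},c_{13},c_{14},c_{15},c_{23},c_{24},c_{25},c_{31},c_{32},c_{34},c_{44},c_{53})$.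 The tuple $Z$ is separating for $I(\mathbb{B}_{\mathcal{O}})$ (i.e. $I(\mathbb{B}_{\mathcal{O}})$ contains a $Z$-separating tuple) and $\Phi:B_{\mathcal{O}}\to K[C\setminus Z]/\langle f_1,f_2\rangle$ is the corresponding separating re-embedding, where $$\begin{aligned} f_1={}& c_{21}c_{41}^2c_{51}^2+c_{41}^2c_{43}c_{51}^2+c_{41}c_{45}c_{51}^3+c_{41}^2c_{42}c_{51}-c_{41}^3c_{52}-c_{41}^2c_{51}c_{54}\\ &+c_{21}c_{41}c_{51}+c_{45}c_{51}^2-c_{41}c_{51}c_{55}+c_{41}c_{42}+c_{41}c_{54}+c_{21}-c_{43},\end{aligned}$$ $$\begin{aligned} f_2={}& -c_{21}^2c_{41}^3c_{51}^5-2c_{21}c_{41}^3c_{43}c_{51}^5-c_{41}^3c_{43}^2c_{51}^5-2c_{21}c_{41}^2c_{45}c_{51}^6-2c_{41}^2c_{43}c_{45}c_{51}^6\\ &-c_{41}c_{45}^2c_{51}^7-c_{21}c_{41}^3c_{42}c_{51}^4-c_{41}^3c_{42}c_{43}c_{51}^4-c_{41}^2c_{42}c_{45}c_{51}^5+c_{21}c_{41}^3c_{51}^4c_{54}\\ &+c_{41}^3c_{43}c_{51}^4c_{54}+c_{41}^2c_{45}c_{51}^5c_{54}-c_{41}^4c_{42}c_{51}^2c_{52}+c_{41}^5c_{51}c_{52}^2+c_{41}^4c_{51}^2c_{52}c_{54}\\ &-c_{41}^2c_{42}c_{43}c_{51}^3-c_{21}c_{41}^3c_{51}^2c_{52}+c_{41}^3c_{43}c_{51}^2c_{52}-c_{41}^2c_{45}c_{51}^3c_{52}\\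 &-2c_{21}c_{41}^2c_{51}^3c_{54}-c_{41}^2c_{43}c_{51}^3c_{54}-2c_{41}c_{45}c_{51}^4c_{54}-c_{41}^2c_{42}c_{51}^3c_{55}\\ &+2c_{41}^3c_{51}^2c_{52}c_{55}+c_{41}^2c_{51}^3c_{54}c_{55}+2c_{21}c_{41}c_{43}c_{51}^3+3c_{41}c_{43}^2c_{51}^3+2c_{43}c_{45}c_{51}^4\\ &-c_{41}^4c_{52}^2-2c_{41}^3c_{51}c_{52}c_{54}+2c_{41}c_{43}c_{51}^3c_{55}+c_{41}c_{51}^3c_{55}^2+c_{41}c_{42}c_{43}c_{51}^2\\ &-c_{42}c_{45}c_{51}^3+c_{21}c_{41}^2c_{51}c_{52}+3c_{41}c_{45}c_{51}^2c_{52}-3c_{41}c_{43}c_{51}^2c_{54}+c_{45}c_{51}^3c_{54}\\ &+c_{41}c_{42}c_{51}^2c_{55}-3c_{41}^2c_{51}c_{52}c_{55}-3c_{41}c_{51}^2c_{54}c_{55}+c_{22}c_{41}c_{51}-2c_{33}c_{41}c_{51}\\ &+c_{21}^2c_{51}^2-c_{35}c_{51}^2-c_{43}^2c_{51}^2+c_{41}^2c_{42}c_{52}+c_{41}^2c_{52}c_{54}+c_{41}c_{51}c_{54}^2\\ &-2c_{43}c_{51}^2c_{55}-c_{51}^2c_{55}^2-c_{41}c_{43}c_{52}-c_{45}c_{51}c_{52}+2c_{43}c_{51}c_{54}+c_{41}c_{52}c_{55}\\ &+2c_{51}c_{54}c_{55}+c_{33}-c_{54}^2.\end{aligned}$$ 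*)

(* Defs.v *)
From HB Require Import structures.
From mathcomp Require Import all_boot all_order all_algebra all_field.
From mathcomp Require Import boolp.
From mathcomp Require Import mpoly.

Set Implicit Arguments.
Unset Strict Implicit.
Unset Printing Implicit Defensive.

Import GRing.Theory.

Local Open Scope ring_scope.
Local Open Scope quotient_scope.

Definition perfect_field (K : fieldType) : Prop :=
  forall p : {poly K}, irreducible_poly p -> separable_poly p.

Definition ideal_span (R : comNzRingType) (gs : seq R) : {pred R} :=
  fun p => `[< exists a : 'I_(size gs) -> R,
                 p = \sum_(i < size gs) a i * gs`_i >].

Section IdealSpan.
Variables (R : comNzRingType) (gs : seq R).

Lemma ideal_spanP p :
  reflect (exists a : 'I_(size gs) -> R, p = \sum_(i < size gs) a i * gs`_i)
          (p \in ideal_span gs).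
Proof. exact: asboolP. Qed.

Lemma ideal_span_closed :
  1 \notin ideal_span gs -> idealr_closed (ideal_span gs).
Proof.
move=> gs1; split=> //.
  by apply/ideal_spanP; exists (fun=> 0); rewrite big1 // => i _; rewrite mul0r.
move=> b _ _ /ideal_spanP[u ->] /ideal_spanP[v ->].
apply/ideal_spanP; exists (fun i => b * u i + v i).
by rewrite mulr_sumr -big_split; apply: eq_bigr => i _; rewrite mulrDl mulrA.
Qed.

(* MathComp's [idealr] only covers proper ideals, hence the side condition.  *)
Definition ideal_gen (gs1 : 1 \notin ideal_span gs) : idealr R :=
  HB.pack (ideal_span gs)
    (isIdealr.Build R (ideal_span gs) (ideal_span_closed gs1)).

End IdealSpan.

Section QuotientAlgebra.
Variables (K : fieldType) (A : comAlgType K) (I : idealr A).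

Definition quot_scale (a : K) (x : {ideal_quot I}) : {ideal_quot I} :=
  \pi_{ideal_quot I} (a *: repr x).

Lemma pi_quot_scale a (p : A) :
  quot_scale a (\pi_{ideal_quot I} p) = \pi_{ideal_quot I} (a *: p).
Proof.
apply/eqP; rewrite -Quotient.idealrBE -scalerBr -mulr_algl.
by rewrite idealMr // Quotient.idealrBE reprK.
Qed.

Fact quot_scalerA a b x :
  quot_scale a (quot_scale b x) = quot_scale (a * b) x.
Proof.
by elim/quotW: x => p; rewrite (pi_quot_scale b) !pi_quot_scale scalerA.
Qed.

Fact quot_scale1r x : quot_scale 1 x = x.
Proof. by elim/quotW: x => p; rewrite pi_quot_scale scale1r. Qed.

Fact quot_scalerDr a x y :
  quot_scale a (x + y) = quot_scale a x + quot_scale a y.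
Proof.
elim/quotW: x => p; elim/quotW: y => q.
by rewrite -rmorphD !pi_quot_scale -rmorphD scalerDr.
Qed.

Fact quot_scalerDl x a b :
  quot_scale (a + b) x = quot_scale a x + quot_scale b x.
Proof.
by elim/quotW: x => p; rewrite !pi_quot_scale -rmorphD scalerDl.
Qed.

HB.instance Definition _ := GRing.Zmodule_isLmodule.Build K (Quotient.quot I)
  quot_scalerA quot_scale1r quot_scalerDr quot_scalerDl.

Fact quot_scalerAl a (x y : Quotient.quot I) : a *: (x * y) = a *: x * y.
Proof.
rewrite /GRing.scale /=; elim/quotW: x => p; elim/quotW: y => q.
by rewrite -rmorphM !pi_quot_scale -rmorphM scalerAl.
Qed.

HB.instance Definition _ := GRing.Lmodule_isLalgebra.Build K (Quotient.quot I)
  quot_scalerAl.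
HB.instance Definition _ :=
  GRing.Lalgebra_isComAlgebra.Build K (Quotient.quot I).

Definition residue_class (p : A) : {ideal_quot I} := \pi_{ideal_quot I} p.

Fact residue_class_zmod_morphism : zmod_morphism residue_class.
Proof. exact: rmorphB. Qed.

Fact residue_class_monoid_morphism : monoid_morphism residue_class.
Proof. by split; [exact: rmorph1 | exact: rmorphM]. Qed.

Fact residue_class_scalable : scalable residue_class.
Proof. by move=> a p; rewrite /residue_class -pi_quot_scale. Qed.

HB.instance Definition _ := GRing.isZmodMorphism.Build A {ideal_quot I}
  residue_class residue_class_zmod_morphism.
HB.instance Definition _ := GRing.isMonoidMorphism.Build A {ideal_quot I}
  residue_class residue_class_monoid_morphism.
HB.instance Definition _ := GRing.isScalable.Build K A {ideal_quot I} *:%R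
  residue_class residue_class_scalable.

End QuotientAlgebra.

Definition term_ordering n (le : rel 'X_{1..n}) : Prop :=
  [/\ total le, antisymmetric le, transitive le,
      (forall t, le 0%MM t)
    & (forall t t1 t2, le t1 t2 -> le (t + t1)%MM (t + t2)%MM)].

(* The leading term is a power product; its coefficient is disregarded.      *)
Definition is_leading_term (K : fieldType) n (le : rel 'X_{1..n})
    (p : {mpoly K[n]}) (t : 'X_{1..n}) : Prop :=
  t \in msupp p /\ {in msupp p, forall t', le t' t}.

Definition separating (K : fieldType) n s (z : s.-tuple 'I_n)
    (p : s.-tuple {mpoly K[n]}) : Prop :=
  uniq z /\
  exists2 le : rel 'X_{1..n}, term_ordering le
    & forall i, is_leading_term le (tnth p i) U_(tnth z i).

Definition coherently_separating (K : fieldType) n s (z : s.-tuple 'I_n)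
    (p : s.-tuple {mpoly K[n]}) : Prop :=
  separating z p /\
  forall i, exists2 h : {mpoly K[n]}, tnth p i = 'X_(tnth z i) - h
    & {in msupp h, forall (t : 'X_{1..n}) j, t (tnth z j) = 0%N}.

(* The polynomial ring in the indeterminates listed by [y], as a subring.    *)
Definition incl (K : fieldType) n m (y : m.-tuple 'I_n) :
    {lrmorphism {mpoly K[m]} -> {mpoly K[n]}} :=
  comp_mpoly [tuple 'X_(tnth y j) | j < m].

(* [y] lists the indeterminates outside [z]; [pr : K[y] -> T] presents [T] as
   the residue class ring of K[y] modulo the elimination ideal of [I].       *)
Definition separating_reembedding (K : fieldType) n s m
    (z : s.-tuple 'I_n) (y : m.-tuple 'I_n) (I : idealr {mpoly K[n]})
    (p : s.-tuple {mpoly K[n]}) (T : comAlgType K)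
    (pr : {lrmorphism {mpoly K[m]} -> T})
    (Phi : {lrmorphism {ideal_quot I} -> T}) : Prop :=
  [/\ perm_eq (z ++ y) (enum 'I_n),
      coherently_separating z p /\ (forall i, tnth p i \in I),
      (forall x, exists q, pr q = x) /\
        (forall q, pr q = 0 <-> incl K y q \in I),
      (exists2 h : s.-tuple {mpoly K[m]},
         (forall i, tnth p i = 'X_(tnth z i) - incl K y (tnth h i))
       & (forall i, Phi (residue_class I 'X_(tnth z i)) = pr (tnth h i))) /\
        (forall j, Phi (residue_class I 'X_(tnth y j)) = pr 'X_j)
    & bijective Phi].

(* The functor of points of the affine scheme Spec A.  MathComp's algebras are
   nonzero; as A and B are, Yoneda's lemma still makes a natural isomorphism
   the same thing as an isomorphism of K-schemes.                            *)
Definition Spec (K : fieldType) (A R : comAlgType K) : Type :=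
  {lrmorphism A -> R}.

Definition Spec_isomorphic (K : fieldType) (A B : comAlgType K) : Prop :=
  exists (F : forall R : comAlgType K, Spec A R -> Spec B R)
         (G : forall R : comAlgType K, Spec B R -> Spec A R),
    [/\ forall R f, G R (F R f) =1 f,
        forall R g, F R (G R g) =1 g
      & forall (R S : comAlgType K) (u : {lrmorphism R -> S}) (f : Spec A R),
          F S (u \o f : {lrmorphism A -> S}) =1 u \o F R f].

(* The exponent pair (a, b) stands for x^a y^b.                              *)
Definition order_terms : seq (nat * nat) :=
  [:: (0, 0); (0, 1); (1, 0); (0, 2); (2, 0)]%N.
Definition border_terms : seq (nat * nat) :=
  [:: (1, 1); (0, 3); (1, 2); (2, 1); (3, 0)]%N.

Definition mul_var (r : nat) (t : nat * nat) : nat * nat :=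
  if r == 1%N then (t.1.+1, t.2) else (t.1, t.2.+1).

(* The indeterminate c_ij carries the label 10 * i + j.                      *)
Definition C_labels : 25.-tuple nat :=
  [tuple of [:: 11; 12; 13; 14; 15; 21; 22; 23; 24; 25; 31; 32; 33; 34; 35;
                41; 42; 43; 44; 45; 51; 52; 53; 54; 55]%N].
Definition Z_labels : 13.-tuple nat :=
  [tuple of [:: 11; 12; 13; 14; 15; 23; 24; 25; 31; 32; 34; 44; 53]%N].
Definition CZ_labels : 12.-tuple nat :=
  [tuple of [:: 21; 22; 33; 35; 41; 42; 43; 45; 51; 52; 54; 55]%N].
Definition Chat_labels : 10.-tuple nat :=
  [tuple of [:: 33; 35; 41; 42; 43; 45; 51; 52; 54; 55]%N].

Definition pos n (L : n.+1.-tuple nat) (l : nat) : 'I_n.+1 :=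
  inord (index l L).

Section LShape.
Variable K : fieldType.

Definition gen_mulmx (r : nat) : 'M[{mpoly K[25]}]_5 :=
  \matrix_(i, j)
    let u := mul_var r (nth (0, 0)%N order_terms j) in
    if u \in order_terms then (i == index u order_terms :> nat)%:R
    else 'X_(pos C_labels (10 * i.+1 + (index u border_terms).+1)).

Definition commutator_mx : 'M[{mpoly K[25]}]_5 :=
  gen_mulmx 1 *m gen_mulmx 2 - gen_mulmx 2 *m gen_mulmx 1.

Definition border_gens : seq {mpoly K[25]} :=
  [seq commutator_mx i j | i <- enum 'I_5, j <- enum 'I_5].

(* The indeterminates of K[C \ Z] = {mpoly K[12]}.                           *)
Definition cvar (l : nat) : {mpoly K[12]} := 'X_(pos CZ_labels l).
Local Notation c l := (cvar l%N).

Definition f1 : {mpoly K[12]} :=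
  c 21 * c 41 ^+ 2 * c 51 ^+ 2 + c 41 ^+ 2 * c 43 * c 51 ^+ 2
  + c 41 * c 45 * c 51 ^+ 3 + c 41 ^+ 2 * c 42 * c 51 - c 41 ^+ 3 * c 52
  - c 41 ^+ 2 * c 51 * c 54 + c 21 * c 41 * c 51 + c 45 * c 51 ^+ 2
  - c 41 * c 51 * c 55 + c 41 * c 42 + c 41 * c 54 + c 21 - c 43.

Definition f2 : {mpoly K[12]} :=
  - c 21 ^+ 2 * c 41 ^+ 3 * c 51 ^+ 5
  - 2 * c 21 * c 41 ^+ 3 * c 43 * c 51 ^+ 5
  - c 41 ^+ 3 * c 43 ^+ 2 * c 51 ^+ 5
  - 2 * c 21 * c 41 ^+ 2 * c 45 * c 51 ^+ 6
  - 2 * c 41 ^+ 2 * c 43 * c 45 * c 51 ^+ 6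
  - c 41 * c 45 ^+ 2 * c 51 ^+ 7 - c 21 * c 41 ^+ 3 * c 42 * c 51 ^+ 4
  - c 41 ^+ 3 * c 42 * c 43 * c 51 ^+ 4
  - c 41 ^+ 2 * c 42 * c 45 * c 51 ^+ 5
  + c 21 * c 41 ^+ 3 * c 51 ^+ 4 * c 54
  + c 41 ^+ 3 * c 43 * c 51 ^+ 4 * c 54
  + c 41 ^+ 2 * c 45 * c 51 ^+ 5 * c 54
  - c 41 ^+ 4 * c 42 * c 51 ^+ 2 * c 52 + c 41 ^+ 5 * c 51 * c 52 ^+ 2
  + c 41 ^+ 4 * c 51 ^+ 2 * c 52 * c 54
  - c 41 ^+ 2 * c 42 * c 43 * c 51 ^+ 3
  - c 21 * c 41 ^+ 3 * c 51 ^+ 2 * c 52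
  + c 41 ^+ 3 * c 43 * c 51 ^+ 2 * c 52
  - c 41 ^+ 2 * c 45 * c 51 ^+ 3 * c 52
  - 2 * c 21 * c 41 ^+ 2 * c 51 ^+ 3 * c 54
  - c 41 ^+ 2 * c 43 * c 51 ^+ 3 * c 54
  - 2 * c 41 * c 45 * c 51 ^+ 4 * c 54
  - c 41 ^+ 2 * c 42 * c 51 ^+ 3 * c 55
  + 2 * c 41 ^+ 3 * c 51 ^+ 2 * c 52 * c 55
  + c 41 ^+ 2 * c 51 ^+ 3 * c 54 * c 55
  + 2 * c 21 * c 41 * c 43 * c 51 ^+ 3 + 3 * c 41 * c 43 ^+ 2 * c 51 ^+ 3
  + 2 * c 43 * c 45 * c 51 ^+ 4 - c 41 ^+ 4 * c 52 ^+ 2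
  - 2 * c 41 ^+ 3 * c 51 * c 52 * c 54
  + 2 * c 41 * c 43 * c 51 ^+ 3 * c 55 + c 41 * c 51 ^+ 3 * c 55 ^+ 2
  + c 41 * c 42 * c 43 * c 51 ^+ 2 - c 42 * c 45 * c 51 ^+ 3
  + c 21 * c 41 ^+ 2 * c 51 * c 52 + 3 * c 41 * c 45 * c 51 ^+ 2 * c 52
  - 3 * c 41 * c 43 * c 51 ^+ 2 * c 54 + c 45 * c 51 ^+ 3 * c 54
  + c 41 * c 42 * c 51 ^+ 2 * c 55 - 3 * c 41 ^+ 2 * c 51 * c 52 * c 55
  - 3 * c 41 * c 51 ^+ 2 * c 54 * c 55 + c 22 * c 41 * c 51
  - 2 * c 33 * c 41 * c 51 + c 21 ^+ 2 * c 51 ^+ 2 - c 35 * c 51 ^+ 2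
  - c 43 ^+ 2 * c 51 ^+ 2 + c 41 ^+ 2 * c 42 * c 52
  + c 41 ^+ 2 * c 52 * c 54 + c 41 * c 51 * c 54 ^+ 2
  - 2 * c 43 * c 51 ^+ 2 * c 55 - c 51 ^+ 2 * c 55 ^+ 2
  - c 41 * c 43 * c 52 - c 45 * c 51 * c 52 + 2 * c 43 * c 51 * c 54
  + c 41 * c 52 * c 55 + 2 * c 51 * c 54 * c 55 + c 33 - c 54 ^+ 2.

Definition psi_img (l : nat) : {mpoly K[12]} :=
  if l == 21%N then
    - c 41 ^+ 2 * c 43 * c 51 ^+ 2 - c 41 * c 45 * c 51 ^+ 3
    + c 41 ^+ 2 * c 42 * c 51 + c 41 ^+ 3 * c 52 + c 41 ^+ 2 * c 51 * c 54
    - c 45 * c 51 ^+ 2 + c 41 * c 51 * c 55 + c 41 * c 42 - c 41 * c 54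
    - c 21 + c 43
  else if l == 22%N then
    2 * c 33 * c 41 * c 51 + 2 * c 35 * c 51 ^+ 2 + 2 * c 22 - c 33
  else if l == 33%N then
    c 33 * c 41 * c 51 + c 35 * c 51 ^+ 2 + c 22
  else if l == 42%N then
    c 41 ^+ 2 * c 43 * c 51 ^+ 3 + c 41 * c 45 * c 51 ^+ 4
    - c 41 ^+ 2 * c 42 * c 51 ^+ 2 - c 41 ^+ 3 * c 51 * c 52
    - c 41 ^+ 2 * c 51 ^+ 2 * c 54 + c 45 * c 51 ^+ 3
    - c 41 * c 51 ^+ 2 * c 55 - c 41 * c 42 * c 51 + c 41 * c 51 * c 54
    + c 21 * c 51 - c 43 * c 51 - c 42
  else c l.

Definition psi : {lrmorphism {mpoly K[12]} -> {mpoly K[12]}} :=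
  comp_mpoly [tuple psi_img (tnth CZ_labels k) | k < 12].

Definition fhat1 : {mpoly K[12]} := c 21.

Definition fhat2 : {mpoly K[12]} :=
  psi f2 \mPo [tuple (if tnth CZ_labels k == 21%N then 0
                      else c (tnth CZ_labels k)) | k < 12].

(* Properness of the ideals: their generators vanish at the origin.          *)
Let vanish n (p : {mpoly K[n]}) : Prop := p.@[fun=> 0] = 0.

Let vanish_proper n (gs : seq {mpoly K[n]}) :
  {in gs, forall g, vanish g} -> 1 \notin ideal_span gs.
Proof.
move=> gs0; apply/ideal_spanP => -[a /(congr1 (meval (fun=> 0)))].
rewrite meval1 raddf_sum big1 => [/eqP|i _] /=; first by rewrite oner_eq0.
by rewrite mevalM [X in _ * X]gs0 ?mulr0 // mem_nth.
Qed.

Let vanishD n (p q : {mpoly K[n]}) : vanish p -> vanish q -> vanish (p + q).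
Proof. by rewrite /vanish mevalD => -> ->; rewrite addr0. Qed.

Let vanishN n (p : {mpoly K[n]}) : vanish p -> vanish (- p).
Proof. by rewrite /vanish mevalN => ->; rewrite oppr0. Qed.

Let vanishM n (p q : {mpoly K[n]}) : vanish q -> vanish (p * q).
Proof. by rewrite /vanish mevalM => ->; rewrite mulr0. Qed.

Let vanishMl n (p q : {mpoly K[n]}) : vanish p -> vanish (p * q).
Proof. by rewrite /vanish mevalM => ->; rewrite mul0r. Qed.

Let vanishXn n (p : {mpoly K[n]}) k : vanish p -> vanish (p ^+ k.+1).
Proof. by rewrite exprS; apply: vanishMl. Qed.

Let vanishX n i : vanish ('X_i : {mpoly K[n]}).
Proof. exact: mevalXU. Qed.

Let vanish_cvar l : vanish (c l).
Proof. exact: vanishX. Qed.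

Let vanish_comp n m (lq : n.-tuple {mpoly K[m]}) p :
  (forall i, vanish (tnth lq i)) -> vanish p -> vanish (p \mPo lq).
Proof.
by move=> lq0 p0; rewrite /vanish comp_mpoly_meval (@meval_eq _ _ _ (fun=> 0)).
Qed.

Ltac vanish :=
  repeat first [ exact: vanish_cvar | apply: vanishD | apply: vanishN
               | apply: vanishXn | apply: vanishM ].

Let f1_vanish : vanish f1. Proof. by rewrite /f1; vanish. Qed.
Let f2_vanish : vanish f2. Proof. by rewrite /f2; vanish. Qed.

Let psi_vanish p : vanish p -> vanish (psi p).
Proof.
apply: vanish_comp => i; rewrite tnth_mktuple /psi_img.
by do !case: ifP => _; vanish.
Qed.

Let fhat2_vanish : vanish fhat2.
Proof.
apply: vanish_comp (psi_vanish f2_vanish) => i; rewrite tnth_mktuple.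
by case: ifP => _; [exact: meval0 | vanish].
Qed.

Let border_gens_vanish : {in border_gens, forall g, vanish g}.
Proof.
pose N r : 'M[K]_5 := \matrix_(i, j)
  (let u := mul_var r (nth (0, 0)%N order_terms j) in
   (u \in order_terms) && (i == index u order_terms :> nat))%:R.
have evN r i j : (gen_mulmx r i j).@[fun=> 0] = N r i j.
  rewrite /gen_mulmx [RHS]mxE [X in meval _ X]mxE.
  move: (mul_var _ _) => u /=.
  by case: (u \in _); [exact: rmorph_nat | exact: mevalXU].
have evNN r s i j :
    ((gen_mulmx r *m gen_mulmx s) i j).@[fun=> 0] = (N r *m N s) i j.
  rewrite [RHS]mxE [X in meval _ X]mxE raddf_sum.
  by apply: eq_bigr => k _; rewrite -evN -evN; apply: mevalM.
have NC : N 1%N *m N 2%N = N 2%N *m N 1%N.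
  apply/matrixP=> i j; rewrite [LHS]mxE [RHS]mxE.
  rewrite !(big_ord_recl, big_ord0) /N !mxE.
  by case: i => [[|[|[|[|[|i]]]]] // ?]; case: j => [[|[|[|[|[|j]]]]] // ?] /=;
    rewrite !(mul0r, mulr0, add0r, addr0).
move=> _ /allpairsP[[i j] [_ _ ->]]; rewrite /vanish /commutator_mx /=.
rewrite [X in meval _ X]mxE [X in meval _ (_ + X)]mxE mevalB.
have NCij : (N 1%N *m N 2%N) i j = (N 2%N *m N 1%N) i j by rewrite NC.
apply/eqP; rewrite subr_eq0; apply/eqP.
exact: etrans (evNN 1%N 2%N i j) (etrans NCij (esym (evNN 2%N 1%N i j))).
Qed.

Fact border_proper : 1 \notin ideal_span border_gens.
Proof. exact: vanish_proper border_gens_vanish. Qed.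

Fact f_proper : 1 \notin ideal_span [:: f1; f2].
Proof. by apply: vanish_proper => g; rewrite !inE => /orP[] /eqP->. Qed.

Fact psi_f_proper : 1 \notin ideal_span [:: psi f1; psi f2].
Proof.
apply: vanish_proper => g; rewrite !inE.
by case/orP=> /eqP->; apply: psi_vanish.
Qed.

Fact fhat_proper : 1 \notin ideal_span [:: fhat1; fhat2].
Proof.
by apply: vanish_proper => g; rewrite !inE => /orP[] /eqP-> //; apply: vanishX.
Qed.

Definition I_BO : idealr {mpoly K[25]} := ideal_gen border_proper.
Definition I_f : idealr {mpoly K[12]} := ideal_gen f_proper.
Definition I_psi_f : idealr {mpoly K[12]} := ideal_gen psi_f_proper.
Definition I_fhat : idealr {mpoly K[12]} := ideal_gen fhat_proper.

Definition B_O : comAlgType K := {ideal_quot I_BO}.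

End LShape.

Definition Z_in_C : 13.-tuple 'I_25 :=
  [tuple pos C_labels (tnth Z_labels j) | j < 13].
Definition CZ_in_C : 12.-tuple 'I_25 :=
  [tuple pos C_labels (tnth CZ_labels j) | j < 12].

Definition c21_c22 : 2.-tuple 'I_12 :=
  [tuple pos CZ_labels 21; pos CZ_labels 22].
Definition Chat_in_CZ : 10.-tuple 'I_12 :=
  [tuple pos CZ_labels (tnth Chat_labels j) | j < 10].

(* Main.v *)
Require Import Defs.
From HB Require Import structures.
From mathcomp Require Import all_boot all_order all_algebra all_field.
From mathcomp Require Import mpoly ring.

Set Implicit Arguments.
Unset Strict Implicit.
Unset Printing Implicit Defensive.

Import GRing.Theory.

Local Open Scope ring_scope.

(** Write x = c41 c51.  The point is that every identity involved is a
    polynomial identity with integer coefficients, so it can be checked on a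
    point with coordinates [v l] in an arbitrary commutative ring R and then
    read in whichever quotient of a polynomial ring is needed.

    Elimination.  Let N be the commutator of the two multiplication matrices.
    Each entry of N below its first row is linear in some element of Z.  Most
    of these equations are solved at once; two loops remain.  The entries (5,2)
    and (5,3) express c53 and c31 through each other, and solving them naively
    would require 1 + x to be invertible; but the entry (4,2) gives c31 c41 as
    a polynomial in the other indeterminates, which breaks the loop and leaves
    the relation f1.  Likewise c24 (1 - x) and c24 c51^2 are polynomials a and
    b in the other indeterminates, hence

      c24 = c24 (1 - x) (1 + x) + c24 c51^2 c41^2 = (1 + x) a + c41^2 b,

    and what remains is the relation f2 = c51^2 a - (1 - x) b
    ([comm_at_eq0_solve]).  Conversely, once the elements of Z are given these
    values, the entries of N below the first row vanish or are multiples of f1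
    and f2: the entries (4,2), (5,3), (2,3), (3,2) are - f1, c51 f1, c41^2 f2,
    (1 + x) f2 ([comm_at_solve]).  The first row of N needs no computation: the
    trace of N M is zero whenever M commutes with one of the two matrices, and
    for M the first or second power of one of them this trace is an entry of
    the first row ([comm_at_eq0]).  So I(B_O) contains the coherently separating tuple
    z - h_z, and its elimination ideal is generated by f1 and f2
    ([residue_f_ker]).

    Straightening.  The substitution psi is invertible, with c21 |-> - f1 in
    its inverse because psi(f1) = - c21.  As f2 is affine in c22, c33, c35,
    psi turns it into c22 plus terms free of c22, c33, c35
    ([f2_at_psi_at] records the absence of c22).  Modulo c21, the polynomial
    psi(f2) is fhat2, so the two ideals agree, and c21, c22 can be eliminated,
    leaving a polynomial ring in ten indeterminates.

    All four isomorphisms come from the first isomorphism theorem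
    ([quot_isomorphism]), the separating re-embeddings through the general
    construction [separating_reembedding_exists]. *)

(** * Ideals, residue class rings and affine schemes *)

Section Quotients.
Variables (K : fieldType) (A : comAlgType K) (I : idealr A).

Lemma residue_class_eq (p q : A) :
  residue_class I p = residue_class I q <-> p - q \in I.
Proof.
by rewrite Quotient.idealrBE; split=> [eq_pq | /eqP]; first exact/eqP.
Qed.

Lemma residue_class_eq0 (p : A) : residue_class I p = 0 <-> p \in I.
Proof. by rewrite -(rmorph0 (residue_class I)) residue_class_eq subr0. Qed.

Lemma residue_class_surj (x : {ideal_quot I}) :
  exists p, residue_class I p = x.
Proof. by exists (repr x); apply: reprK. Qed.

(** The first isomorphism theorem for algebras; the inverse map is a choice of
    preimages under [g], which is harmless modulo the kernel. *)
Lemma quot_isomorphism (T : comAlgType K) (g : {lrmorphism A -> T}) :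
  (forall p, g p = 0 <-> p \in I) -> (forall t, exists p, g p = t) ->
  exists G : {lrmorphism {ideal_quot I} -> T},
    (forall p, G (residue_class I p) = g p) /\ bijective G.
Proof.
move=> kerg surjg.
pose G0 (x : {ideal_quot I}) : T := g (repr x).
have G0E p : G0 (residue_class I p) = g p.
  apply/subr0_eq; rewrite -rmorphB; apply/kerg/residue_class_eq.
  exact: reprK.
have G0B : zmod_morphism G0.
  move=> x y.
  have [[p <-] [q <-]] := (residue_class_surj x, residue_class_surj y).
  by rewrite -rmorphB !G0E rmorphB.
have G0M : monoid_morphism G0.
  split=> [|x y]; first by rewrite -(rmorph1 (residue_class I)) G0E rmorph1.
  have [[p <-] [q <-]] := (residue_class_surj x, residue_class_surj y).
  by rewrite -rmorphM !G0E rmorphM.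
have G0Z : scalable G0.
  move=> a x; have [p <-] := residue_class_surj x.
  by rewrite -linearZ !G0E linearZ.
pose G : {lrmorphism {ideal_quot I} -> T} := HB.pack G0
  (GRing.isZmodMorphism.Build _ _ G0 G0B)
  (GRing.isMonoidMorphism.Build _ _ G0 G0M)
  (GRing.isScalable.Build _ _ _ _ G0 G0Z).
exists G; split=> //.
have ex t : exists p, g p == t by have [p <-] := surjg t; exists p.
exists (fun t => residue_class I (xchoose (ex t))) => [x|t]; last first.
  by rewrite [LHS]G0E; apply/eqP/(xchooseP (ex t)).
have [p <-] := residue_class_surj x; apply/residue_class_eq/kerg.
apply/eqP; rewrite rmorphB subr_eq0; apply/eqP/(etrans _ (G0E p)).
exact/eqP/(xchooseP (ex _)).
Qed.

End Quotients.

Lemma bijective_Spec_isomorphic (K : fieldType) (A B : comAlgType K)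
    (f : {lrmorphism A -> B}) : bijective f -> Spec_isomorphic A B.
Proof.
case=> g0 fK g0K.
pose g : {lrmorphism B -> A} := HB.pack g0
  (GRing.isZmodMorphism.Build _ _ g0 (can2_zmod_morphism fK g0K))
  (GRing.isMonoidMorphism.Build _ _ g0 (can2_monoid_morphism fK g0K))
  (GRing.isScalable.Build _ _ _ _ g0 (can2_scalable fK g0K)).
exists (fun R (h : Spec A R) => h \o g : {lrmorphism B -> R}).
exists (fun R (h : Spec B R) => h \o f : {lrmorphism A -> R}).
split=> [R h x|R h x|//]; first by rewrite /= fK.
by rewrite /= g0K.
Qed.

Lemma ideal_span_mem (R : comNzRingType) (gs : seq R) (g : R) :
  g \in gs -> g \in ideal_span gs.
Proof.
move=> /(nthP 0) [k ltk <-]; apply/ideal_spanP.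
exists (fun i => (i == Ordinal ltk)%:R).
rewrite (bigD1 (Ordinal ltk)) //= eqxx mul1r big1 ?addr0 // => i /negPf->.
by rewrite mul0r.
Qed.

Lemma ideal_span_rmorph0 (R S : comNzRingType) (gs : seq R)
    (f : {rmorphism R -> S}) :
  {in gs, forall g, f g = 0} -> {in ideal_span gs, forall p, f p = 0}.
Proof.
move=> f0 _ /ideal_spanP[a ->]; rewrite rmorph_sum big1 // => i _.
by rewrite rmorphM [X in _ * X]f0 ?mulr0 ?mem_nth.
Qed.

(** * Polynomials and their substitutions *)

Lemma mpoly_morph_ext (K : fieldType) n (T : comAlgType K)
    (f g : {lrmorphism {mpoly K[n]} -> T}) :
  (forall i, f 'X_i = g 'X_i) -> f =1 g.
Proof.
move=> fg p; rewrite (mpolyE p) !linear_sum; apply: eq_bigr => t _.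
rewrite !linearZ mpolyXE_id !rmorph_prod; congr (_ *: _).
by apply: eq_bigr => i _; rewrite !rmorphXn; congr (_ ^+ _); apply: fg.
Qed.

Lemma comp_mpoly_tnth (K : fieldType) n m (lq : n.-tuple {mpoly K[m]}) i :
  'X_i \mPo lq = tnth lq i.
Proof. by rewrite comp_mpolyXU -tnth_nth. Qed.

(** * Elimination term orderings *)

Section TermOrderings.
Variables (K : fieldType) (n : nat) (S : pred 'I_n).

Definition weight (t : 'X_{1..n}) : nat := (\sum_(i | S i) t i)%N.

(** Comparing the degree in the indeterminates of [S] first makes each of them
    larger than every term free of [S]; ties are broken by a fixed term
    ordering. *)
Definition elim_le : rel 'X_{1..n} := fun t1 t2 =>
  (weight t1 < weight t2)%N || (weight t1 == weight t2) && (t1 <= t2)%O.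

Lemma weightD t1 t2 : weight (t1 + t2)%MM = (weight t1 + weight t2)%N.
Proof. by rewrite /weight -big_split; apply: eq_bigr => i _; rewrite mnmDE. Qed.

Lemma elim_le_term_ordering : term_ordering elim_le.
Proof.
rewrite /elim_le; split.
- move=> t1 t2; case: (ltngtP (weight t1) (weight t2)) => //= _.
  exact: Order.TotalTheory.le_total.
- move=> t1 t2; case: (ltngtP (weight t1) (weight t2)) => //= _.
  exact: Order.POrderTheory.le_anti.
- move=> t2 t1 t3 /orP[lt12 | /andP[/eqP-> le12]].
    case/orP=> [lt23 | /andP[/eqP<- _]]; last by rewrite lt12.
    by rewrite (ltn_trans lt12 lt23).
  case/orP=> [-> // | /andP[-> le23]].
  by rewrite (Order.POrderTheory.le_trans le12 le23) orbT.
- move=> t; rewrite le0m andbT orbC -leq_eqVlt.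
  by rewrite {1}/weight big1 // => i _; rewrite mnm0E.
- by move=> t t1 t2; rewrite !weightD ltn_add2l eqn_add2l lemc_add2r.
Qed.

Definition avoids (p : {mpoly K[n]}) : Prop :=
  {in msupp p, forall (t : 'X_{1..n}) i, S i -> t i = 0%N}.

Lemma avoidsX i : ~~ S i -> avoids 'X_i.
Proof.
move=> nSi t; rewrite msuppX inE => /eqP-> j Sj; rewrite mnm1E.
by case: eqP Sj nSi => // -> ->.
Qed.

Lemma avoids0 : avoids 0.
Proof. by move=> t; rewrite msupp0. Qed.

Lemma avoids1 : avoids 1.
Proof. by move=> t; rewrite msupp1 inE => /eqP-> i _; rewrite mnm0E. Qed.

Lemma avoidsD p q : avoids p -> avoids q -> avoids (p + q).
Proof.
by move=> Fp Fq t /msuppD_le; rewrite mem_cat => /orP[/Fp | /Fq].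
Qed.

Lemma avoidsN p : avoids p -> avoids (- p).
Proof. by move=> Fp t; rewrite (perm_mem (msuppN p)); apply: Fp. Qed.

Lemma avoidsZ a p : avoids p -> avoids (a *: p).
Proof. by move=> Fp t /msuppZ_le /Fp. Qed.

Lemma avoidsM p q : avoids p -> avoids q -> avoids (p * q).
Proof.
move=> Fp Fq _ /msuppM_le/allpairsP[[t u] /= [pt qu ->]] i Si.
by rewrite mnmDE (Fp t) ?(Fq u).
Qed.

Lemma leading_term_subr i g :
  S i -> avoids g -> is_leading_term elim_le ('X_i - g) U_(i).
Proof.
move=> Si Fg; have Ui1 : weight U_(i) = 1%N.
  rewrite /weight (bigD1 i) //= mnm1E eqxx big1 // => j /andP[_ /negPf].
  by rewrite mnm1E eq_sym => ->.
split.
  rewrite mcoeff_msupp mcoeffB mcoeffXU eqxx memN_msupp_eq0 ?subr0 ?oner_eq0 //.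
  by apply/negP => /Fg/(_ i Si); rewrite mnm1E eqxx.
move=> t /msuppB_le; rewrite mem_cat msuppX inE /elim_le.
case/orP=> [/eqP-> | /Fg t0]; last by rewrite Ui1 [weight t]big1.
by rewrite eqxx Order.POrderTheory.le_refl orbT.
Qed.

Lemma leading_term_oppX i :
  is_leading_term elim_le (- 'X_i : {mpoly K[n]}) U_(i).
Proof.
split=> [|t]; rewrite (perm_mem (msuppN _)) msuppX inE // => /eqP->.
by rewrite /elim_le eqxx Order.POrderTheory.le_refl orbT.
Qed.

End TermOrderings.

Lemma avoids_comp_mpoly (K : fieldType) n m (S : pred 'I_m)
    (lq : n.-tuple {mpoly K[m]}) (p : {mpoly K[n]}) :
  (forall i, avoids S (tnth lq i)) -> avoids S (p \mPo lq).
Proof.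
move=> Flq; rewrite comp_mpolyEX; apply: (big_ind (avoids S)).
- exact: avoids0.
- exact: avoidsD.
move=> t _; rewrite comp_mpolyX; apply: avoidsZ; apply: (big_ind (avoids S)).
- exact: avoids1.
- exact: avoidsM.
move=> i _; elim: (t i) => [|k IHk]; first by rewrite expr0; apply: avoids1.
by rewrite exprS; apply: avoidsM.
Qed.

(** * Separating re-embeddings *)

Section Reembedding.
Variables (K : fieldType) (n s m : nat) (z : s.-tuple 'I_n) (y : m.-tuple 'I_n).
Hypothesis zy : perm_eq (z ++ y) (enum 'I_n).

Lemma inclX j : incl K y 'X_j = 'X_(tnth y j).
Proof. by rewrite /incl /= comp_mpoly_tnth tnth_mktuple. Qed.

Let uniq_zy : uniq (z ++ y). Proof. by rewrite (perm_uniq zy) enum_uniq. Qed.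

Lemma uniq_separated : uniq z.
Proof. by have := uniq_zy; rewrite cat_uniq => /and3P[]. Qed.

Lemma avoids_incl (q : {mpoly K[m]}) : avoids (mem z) (incl K y q).
Proof.
apply: avoids_comp_mpoly => j; rewrite tnth_mktuple; apply: avoidsX.
have := uniq_zy; rewrite cat_uniq => /and3P[_ /hasPn nyz _].
exact/nyz/mem_tnth.
Qed.

Lemma coherently_separating_subr (p : s.-tuple {mpoly K[n]})
    (h : s.-tuple {mpoly K[m]}) :
  (forall i, tnth p i = 'X_(tnth z i) - incl K y (tnth h i)) ->
  coherently_separating z p.
Proof.
move=> ph; split; last first.
  move=> i; exists (incl K y (tnth h i)) => // t /avoids_incl t0 j.
  exact/t0/mem_tnth.
split; first exact: uniq_separated.
exists (elim_le (mem z)) => [|i]; first exact: elim_le_term_ordering.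
by rewrite ph; apply: leading_term_subr; [apply: mem_tnth | apply: avoids_incl].
Qed.

Lemma index_tnth k (L : k.-tuple 'I_n) i : uniq L -> index (tnth L i) L = i.
Proof. by move=> uL; rewrite (tnth_nth (tnth L i)) index_uniq ?size_tuple. Qed.

(** The default values of [nth] are never reached when [z] and [y] together list
    all indeterminates. *)
Definition eliminate (h : s.-tuple {mpoly K[m]}) :
    {lrmorphism {mpoly K[n]} -> {mpoly K[m]}} :=
  comp_mpoly [tuple if k \in z then nth 0 h (index k z)
                    else nth 0 [tuple 'X_j | j < m] (index k y) | k < n].

Lemma eliminate_z h i : eliminate h 'X_(tnth z i) = tnth h i.
Proof.
rewrite [LHS]comp_mpoly_tnth tnth_mktuple mem_tnth.
by rewrite index_tnth ?uniq_separated // -tnth_nth.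
Qed.

Lemma eliminate_y h j : eliminate h 'X_(tnth y j) = 'X_j.
Proof.
have := uniq_zy; rewrite cat_uniq => /and3P[_ /hasPn nyz uy].
rewrite [LHS]comp_mpoly_tnth tnth_mktuple.
rewrite (negPf (nyz _ (mem_tnth j y))) index_tnth //.
by rewrite -tnth_nth tnth_mktuple.
Qed.

Lemma eliminateK h : cancel (incl K y) (eliminate h).
Proof.
have ext := mpoly_morph_ext (f := eliminate h \o incl K y) (g := idfun).
by apply: ext => j; rewrite /= inclX eliminate_y.
Qed.

(** Modulo [I], every [q] equals the polynomial [eliminate h q] in the remaining
    indeterminates.  So [q] lies in [I] exactly when [eliminate h q] lies in the
    elimination ideal, that is, in the kernel of [pr], and [pr \o eliminate h]
    induces the required isomorphism. *)
Lemma separating_reembedding_exists (I : idealr {mpoly K[n]})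
    (p : s.-tuple {mpoly K[n]}) (h : s.-tuple {mpoly K[m]})
    (T : comAlgType K) (pr : {lrmorphism {mpoly K[m]} -> T}) :
  (forall i, tnth p i = 'X_(tnth z i) - incl K y (tnth h i)) ->
  (forall i, tnth p i \in I) ->
  (forall x, exists q, pr q = x) ->
  (forall q, pr q = 0 <-> incl K y q \in I) ->
  exists Phi : {lrmorphism {ideal_quot I} -> T},
    separating_reembedding z y p pr Phi.
Proof.
move=> ph pI pr_surj pr_ker.
have elimI q : residue_class I q = residue_class I (incl K y (eliminate h q)).
  have ext := mpoly_morph_ext (f := residue_class I)
    (g := residue_class I \o (incl K y \o eliminate h)).
  apply: ext => k; have: k \in z ++ y by rewrite (perm_mem zy) mem_enum.
  rewrite mem_cat => /orP[] /tnthP[i ->] /=; last by rewrite eliminate_y inclX.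
  by apply/residue_class_eq; rewrite eliminate_z -ph.
have kerg q : pr (eliminate h q) = 0 <-> q \in I.
  by rewrite pr_ker -!residue_class_eq0 -elimI.
have surjg x : exists q, pr (eliminate h q) = x.
  by have [q <-] := pr_surj x; exists (incl K y q); rewrite eliminateK.
have [Phi [PhiE Phi_bij]] :=
  quot_isomorphism (g := pr \o eliminate h) kerg surjg.
exists Phi; split=> //.
- by split=> //; apply: coherently_separating_subr ph.
- split; last by move=> j; rewrite PhiE /= eliminate_y.
  by exists h => // i; rewrite PhiE /= eliminate_z.
Qed.

End Reembedding.

(** * Indeterminates addressed by labels *)

Lemma pos_tnth n (L : n.+1.-tuple nat) i : uniq L -> pos L (tnth L i) = i.
Proof.
by move=> uL; rewrite /pos (tnth_nth 0%N) index_uniq ?size_tuple ?inord_val.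
Qed.

Lemma tnth_pos n (L : n.+1.-tuple nat) l : l \in L -> tnth L (pos L l) = l.
Proof.
move=> Ll; rewrite (tnth_nth 0%N) /pos inordK ?nth_index //.
by rewrite -[X in (_ < X)%N](size_tuple L) index_mem.
Qed.

Lemma labels_morph_ext (K : fieldType) n (L : n.+1.-tuple nat)
    (T : comAlgType K) (f g : {lrmorphism {mpoly K[n.+1]} -> T}) :
  uniq L -> {in L, forall l, f 'X_(pos L l) = g 'X_(pos L l)} -> f =1 g.
Proof.
move=> uL fg; apply: mpoly_morph_ext => i.
by rewrite -(pos_tnth i uL); apply/fg/mem_tnth.
Qed.

Lemma comp_mpoly_label (K : fieldType) n m (L : n.+1.-tuple nat)
    (w : nat -> {mpoly K[m]}) l :
  l \in L -> 'X_(pos L l) \mPo [tuple w (tnth L k) | k < n.+1] = w l.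
Proof. by move=> Ll; rewrite comp_mpoly_tnth tnth_mktuple tnth_pos. Qed.

Lemma perm_pos n (L : n.+1.-tuple nat) (ls : seq nat) :
  uniq L -> perm_eq ls L -> perm_eq (map (pos L) ls) (enum 'I_n.+1).
Proof.
move=> uL /(perm_map (pos L)); congr perm_eq.
rewrite -(map_tnth_enum L) -map_comp -[RHS]map_id.
by apply: eq_map => i; apply: pos_tnth.
Qed.

Lemma mktuple_pos n k (L : n.+1.-tuple nat) (t : k.-tuple nat) :
  [tuple pos L (tnth t j) | j < k] = map (pos L) t :> seq _.
Proof. by rewrite -(map_tnth_enum t) -map_comp. Qed.

Lemma in_CZ_labels (P : nat -> Prop) :
  [/\ P 21, P 22, P 33 & P 35]%N -> [/\ P 41, P 42, P 43 & P 45]%N ->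
  [/\ P 51, P 52, P 54 & P 55]%N -> {in CZ_labels, forall l, P l}.
Proof.
move=> [p1 p2 p3 p4] [q1 q2 q3 q4] [r1 r2 r3 r4] l.
by rewrite !inE; do !case/predU1P=> [-> //|]; move/eqP->.
Qed.

(** * The commutator of the multiplication matrices *)

(** If M commutes with A, then tr (A B M) = tr (B M A) = tr (B A M); the other
    case is symmetric. *)
Lemma mxtrace_commutator_mul (R : comNzRingType) n (A B M : 'M[R]_n) :
  comm_mx A M \/ comm_mx B M -> \tr ((A *m B - B *m A) *m M) = 0.
Proof.
rewrite /comm_mx mulmxBl raddfB /= => -[cM | cM].
  by rewrite -mulmxA mxtrace_mulC -!mulmxA cM subrr.
by rewrite -!mulmxA [X in _ - X]mxtrace_mulC -!mulmxA cM subrr.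
Qed.

Section BorderEquations.
Variables (R : comNzRingType) (v : nat -> R).
Local Notation c l := (v l%N).

Definition mulmx_at (r : nat) : 'M[R]_5 :=
  \matrix_(i, j)
    let u := mul_var r (nth (0, 0)%N order_terms j) in
    if u \in order_terms then (i == index u order_terms :> nat)%:R
    else c (10 * i.+1 + (index u border_terms).+1).

Definition comm_at : 'M[R]_5 :=
  mulmx_at 1 *m mulmx_at 2 - mulmx_at 2 *m mulmx_at 1.

(** The rows of [comm_at] below the first one; their first entries vanish
    because x and y commute on 1. *)
Definition lower_entries : seq (seq R) :=
  [:: [:: 0; - c 11 + c 23 - c 21 * c 31 - c 22 * c 41 - c 24 * c 51;
          - c 24 + c 21 ^+ 2 + c 23 * c 41 + c 25 * c 51;
          - c 13 + c 21 * c 22 - c 21 * c 33 - c 22 * c 43 + c 23 * c 42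
            - c 24 * c 53 + c 25 * c 52;
          - c 15 + c 21 * c 24 - c 21 * c 35 - c 22 * c 45 + c 23 * c 44
            - c 24 * c 55 + c 25 * c 54];
      [:: 0; c 33 - c 31 ^+ 2 - c 32 * c 41 - c 34 * c 51;
          c 11 - c 34 + c 21 * c 31 + c 33 * c 41 + c 35 * c 51;
          c 12 + c 22 * c 31 - c 31 * c 33 - c 32 * c 43 + c 33 * c 42
            - c 34 * c 53 + c 35 * c 52;
          c 14 + c 24 * c 31 - c 31 * c 35 - c 32 * c 45 + c 33 * c 44
            - c 34 * c 55 + c 35 * c 54];
      [:: 0; - c 21 + c 43 - c 31 * c 41 - c 41 * c 42 - c 44 * c 51;
          - c 44 + c 21 * c 41 + c 41 * c 43 + c 45 * c 51;
          - c 23 + c 22 * c 41 - c 33 * c 41 - c 44 * c 53 + c 45 * c 52;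
          - c 25 + c 24 * c 41 - c 35 * c 41 - c 42 * c 45 + c 43 * c 44
            - c 44 * c 55 + c 45 * c 54];
      [:: 0; c 53 - c 31 * c 51 - c 41 * c 52 - c 51 * c 54;
          c 31 - c 54 + c 21 * c 51 + c 41 * c 53 + c 51 * c 55;
          c 32 + c 22 * c 51 - c 33 * c 51 + c 42 * c 53 - c 43 * c 52
            + c 52 * c 55 - c 53 * c 54;
          c 34 + c 24 * c 51 - c 35 * c 51 + c 44 * c 53 - c 45 * c 52]].

Lemma comm_atE (i j : 'I_5) :
  (0 < i)%N -> comm_at i j = nth 0 (nth [::] lower_entries i.-1) j.
Proof.
have xE (k l : 'I_5) : mulmx_at 1 k l = nth 0 (nth [::]
    [:: [:: 0; c 11; 0; c 13; c 15]; [:: 0; c 21; 0; c 23; c 25];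
        [:: 1; c 31; 0; c 33; c 35]; [:: 0; c 41; 0; c 43; c 45];
        [:: 0; c 51; 1; c 53; c 55]] k) l.
  by case: k => [[|[|[|[|[|k]]]]] // ?]; case: l => [[|[|[|[|[|l]]]]] // ?];
    rewrite mxE.
have yE (k l : 'I_5) : mulmx_at 2 k l = nth 0 (nth [::]
    [:: [:: 0; 0; c 11; c 12; c 14]; [:: 1; 0; c 21; c 22; c 24];
        [:: 0; 0; c 31; c 32; c 34]; [:: 0; 1; c 41; c 42; c 44];
        [:: 0; 0; c 51; c 52; c 54]] k) l.
  by case: k => [[|[|[|[|[|k]]]]] // ?]; case: l => [[|[|[|[|[|l]]]]] // ?];
    rewrite mxE.
rewrite !mxE !big_ord_recl !big_ord0 !xE !yE.
by case: i => [[|[|[|[|[|i]]]]] // ?]; case: j => [[|[|[|[|[|j]]]]] // ?] _ /=;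
  ring.
Qed.

(** When only the first row of the commutator N can be nonzero, the trace of N M
    is the product of that row with the first column of M.  The powers A1, A1^2,
    A2, A2^2 send 1 to x, x^2, y, y^2, so their first columns are unit vectors
    and the four traces, which vanish by [mxtrace_commutator_mul], are the
    entries of the first row. *)
Lemma comm_at_eq0 :
  (forall i j : 'I_5, (0 < i)%N -> (0 < j)%N -> comm_at i j = 0) -> comm_at = 0.
Proof.
move=> low0.
have low (i j : 'I_5) : (0 < i)%N -> comm_at i j = 0.
  move=> i0; case: (posnP j) => [j0 | ]; last exact: low0.
  rewrite comm_atE // j0.
  by case: i i0 => [[|[|[|[|[|i]]]]] // ?].
have top M : \tr (comm_at *m M) = \sum_j comm_at ord0 j * M j ord0.
  rewrite /mxtrace big_ord_recl mxE [X in _ + X]big1 ?addr0 // => i _.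
  by rewrite mxE big1 // => j _; rewrite low ?mul0r.
have top0 (j : 'I_5) (M : 'M_5) :
    comm_mx (mulmx_at 1) M \/ comm_mx (mulmx_at 2) M ->
    (forall k : 'I_5, M k ord0 = (k == j :> nat)%:R) -> comm_at ord0 j = 0.
  move=> cM Mj; rewrite -(mxtrace_commutator_mul cM) top (bigD1 j) //= Mj eqxx.
  rewrite mulr1 big1 ?addr0 // => k /negPf k'j.
  by rewrite Mj val_eqE k'j mulr0.
have sqC r : comm_mx (mulmx_at r) (mulmx_at r *m mulmx_at r).
  exact: comm_mxM.
apply/matrixP => i j; rewrite [RHS]mxE.
case: (posnP i) => [i0 | ]; last exact: low.
have ->: i = ord0 by apply: val_inj.
have col1 : {in [:: (1, 2); (2, 1)]%N, forall rn (k : 'I_5),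
    mulmx_at rn.1 k ord0 = (k == rn.2 :> nat)%:R}.
  by move=> [r n]; rewrite !inE => /orP[] /eqP[-> ->] k; rewrite mxE.
have col2 : {in [:: (1, 4); (2, 3)]%N, forall rn (k : 'I_5),
    (mulmx_at rn.1 *m mulmx_at rn.1) k ord0 = (k == rn.2 :> nat)%:R}.
  move=> [r n]; rewrite !inE => /orP[] /eqP[-> ->] k; rewrite mxE;
  by rewrite !big_ord_recl big_ord0 !mxE /=;
    case: k => [[|[|[|[|[|k]]]]] // ?] /=;
    rewrite ?(mulr0, mulr1, addr0, add0r).
case: j => [[|[|[|[|[|j]]]]] // ltj].
- rewrite !mxE !big_ord_recl !big_ord0 !mxE /=.
  by rewrite !(mulr0, mulr1, mul0r, mul1r, addr0, add0r) subrr.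
- by apply: (top0 _ (mulmx_at 2)) => [|k]; [right | apply: (col1 (2, 1)%N)].
- by apply: (top0 _ (mulmx_at 1)) => [|k]; [left | apply: (col1 (1, 2)%N)].
- by apply: (top0 _ (mulmx_at 2 *m mulmx_at 2)) => [|k];
    [right | apply: (col2 (2, 3)%N)].
- by apply: (top0 _ (mulmx_at 1 *m mulmx_at 1)) => [|k];
    [left | apply: (col2 (1, 4)%N)].
Qed.

End BorderEquations.

(** * Solving the border relations for the indeterminates of Z *)

Section Elimination.
Variables (R : comNzRingType) (v : nat -> R).
Local Notation c l := (v l%N).

(** [hij] is the value of the eliminated c_ij in terms of the remaining
    coordinates. The auxiliary [h31c41] and [h44h53] are the values of c31 c41 and
    c44 c53 - c45 c52, [h25_rest] and [h34_rest] those of c25 - c24 c41 and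
    c34 + c24 c51, and [h24a] and [h24b] those of c24 (1 - c41 c51) and
    c24 c51^2. *)
Definition h44 := c 21 * c 41 + c 41 * c 43 + c 45 * c 51.
Definition h31c41 := c 43 - c 21 - c 41 * c 42 - h44 * c 51.
Definition h31 :=
  c 54 - c 21 * c 51 - c 51 * h31c41 - c 41 ^+ 2 * c 52 - c 41 * c 51 * c 54
  - c 51 * c 55.
Definition h53 := h31 * c 51 + c 41 * c 52 + c 51 * c 54.
Definition h44h53 := h44 * h53 - c 45 * c 52.
Definition h23 := c 22 * c 41 - c 33 * c 41 - h44h53.
Definition h32 :=
  c 33 * c 51 - c 22 * c 51 - c 42 * h53 + c 43 * c 52 - c 52 * c 55
  + h53 * c 54.
Definition h25_rest :=
  c 43 * h44 + c 45 * c 54 - c 35 * c 41 - c 42 * c 45 - h44 * c 55.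
Definition h34_rest := c 35 * c 51 - h44h53.
Definition h24a := c 21 ^+ 2 + h23 * c 41 + c 51 * h25_rest.
Definition h24b := h34_rest * c 51 + h31 ^+ 2 + h32 * c 41 - c 33.
Definition h24 := h24a * (1 + c 41 * c 51) + c 41 ^+ 2 * h24b.
Definition h25 := h24 * c 41 + h25_rest.
Definition h34 := h34_rest - h24 * c 51.
Definition h11 := h23 - c 21 * h31 - c 22 * c 41 - h24 * c 51.
Definition h12 :=
  h31 * c 33 + h32 * c 43 + h34 * h53 - c 22 * h31 - c 33 * c 42 - c 35 * c 52.
Definition h13 :=
  c 21 * c 22 - c 21 * c 33 - c 22 * c 43 + h23 * c 42 - h24 * h53 + h25 * c 52.
Definition h14 :=
  h31 * c 35 + h32 * c 45 + h34 * c 55 - h24 * h31 - c 33 * h44 - c 35 * c 54.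
Definition h15 :=
  c 21 * h24 - c 21 * c 35 - c 22 * c 45 + h23 * h44 - h24 * c 55 + h25 * c 54.

(** The relations f1 and f2 say that the two available values of c31 c41, and
    of c24 (1 - c41 c51) c51^2, agree. *)
Definition f1_at := h31 * c 41 - h31c41.
Definition f2_at := h24a * c 51 ^+ 2 - (1 - c 41 * c 51) * h24b.

Definition solve_at (l : nat) : R :=
  match l with
  | 11 => h11 | 12 => h12 | 13 => h13 | 14 => h14 | 15 => h15 | 23 => h23
  | 24 => h24 | 25 => h25 | 31 => h31 | 32 => h32 | 34 => h34 | 44 => h44
  | 53 => h53 | _ => c l
  end%N.

Local Notation entry i j :=
  (nth 0 (nth [::] (lower_entries v) (i%N.-2)) (j%N.-1)).

(** Each entry of the commutator solves for one more element of Z, in the order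
    in which the definitions above depend on each other. *)
Lemma comm_at_eq0_solve :
  comm_at v = 0 -> [/\ forall l, c l = solve_at l, f1_at = 0 & f2_at = 0].
Proof.
move=> N0.
have e0 i j : (1 < i <= 5)%N -> (0 < j <= 5)%N -> entry i j = 0.
  case: i j => [|[|i]] // [|j] //= lti ltj.
  by rewrite -(@comm_atE _ v (Ordinal lti) (Ordinal ltj)) // N0 mxE.
have combine (a b d : R) : a - b = d -> d = 0 -> a = b.
  by move=> <- /subr0_eq.
have d44 : c 44 = h44.
  apply: (combine _ _ (- entry 4 3)); last by rewrite e0 ?oppr0.
  by rewrite /h44 /=; ring.
have d31c41 : c 31 * c 41 = h31c41.
  apply: (combine _ _ (- entry 4 2)); last by rewrite e0 ?oppr0.
  by rewrite /h31c41 -d44 /=; ring.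
have d31 : c 31 = h31.
  (* Replacing c53 by means of the entry (5,2) leaves the product c31 c41. *)
  apply: (combine _ _ (entry 5 3 - c 41 * entry 5 2)); last first.
    by rewrite !e0 // mulr0 subr0.
  by rewrite /h31 -d31c41 /=; ring.
have d53 : c 53 = h53.
  apply: (combine _ _ (entry 5 2)); last by rewrite e0.
  by rewrite /h53 -d31 /=; ring.
have d44h53 : c 44 * c 53 - c 45 * c 52 = h44h53 by rewrite /h44h53 -d44 -d53.
have d23 : c 23 = h23.
  apply: (combine _ _ (- entry 4 4)); last by rewrite e0 ?oppr0.
  by rewrite /h23 -d44h53 /=; ring.
have d32 : c 32 = h32.
  apply: (combine _ _ (entry 5 4)); last by rewrite e0.
  by rewrite /h32 -d53 /=; ring.
have d25_rest : c 25 - c 24 * c 41 = h25_rest.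
  apply: (combine _ _ (- entry 4 5)); last by rewrite e0 ?oppr0.
  by rewrite /h25_rest -d44 /=; ring.
have d34_rest : c 34 + c 24 * c 51 = h34_rest.
  apply: (combine _ _ (entry 5 5)); last by rewrite e0.
  by rewrite /h34_rest -d44h53 /=; ring.
have d24a : c 24 * (1 - c 41 * c 51) = h24a.
  apply: (combine _ _ (- entry 2 3)); last by rewrite e0 ?oppr0.
  by rewrite /h24a -d23 -d25_rest /=; ring.
have d24b : c 24 * c 51 ^+ 2 = h24b.
  apply: (combine _ _ (entry 3 2)); last by rewrite e0.
  by rewrite /h24b -d34_rest -d31 -d32 /=; ring.
(* This uses (1 - c41 c51) (1 + c41 c51) + c41^2 c51^2 = 1. *)
have d24 : c 24 = h24 by rewrite /h24 -d24a -d24b; ring.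
have d25 : c 25 = h25 by rewrite /h25 -d25_rest -d24; ring.
have d34 : c 34 = h34 by rewrite /h34 -d34_rest -d24; ring.
have d11 : c 11 = h11.
  apply: (combine _ _ (- entry 2 2)); last by rewrite e0 ?oppr0.
  by rewrite /h11 -d23 -d31 -d24 /=; ring.
have d12 : c 12 = h12.
  apply: (combine _ _ (entry 3 4)); last by rewrite e0.
  by rewrite /h12 -d31 -d32 -d34 -d53 /=; ring.
have d13 : c 13 = h13.
  apply: (combine _ _ (- entry 2 4)); last by rewrite e0 ?oppr0.
  by rewrite /h13 -d23 -d24 -d25 -d53 /=; ring.
have d14 : c 14 = h14.
  apply: (combine _ _ (entry 3 5)); last by rewrite e0.
  by rewrite /h14 -d24 -d31 -d32 -d34 -d44 /=; ring.
have d15 : c 15 = h15.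
  apply: (combine _ _ (- entry 2 5)); last by rewrite e0 ?oppr0.
  by rewrite /h15 -d23 -d24 -d25 -d44 /=; ring.
split.
- by move=> l; do 54! [case: l => [|l] //].
- by rewrite /f1_at -d31 -d31c41 subrr.
- by rewrite /f2_at -d24a -d24b; ring.
Qed.

End Elimination.

(** The sixteen entries treated are those of rows 2 to 5 and columns 2 to 5; the
    four that are not zero by definition of the values are multiples of the
    relations f1 and f2. *)
Lemma comm_at_solve (R : comNzRingType) (v : nat -> R) :
  f1_at v = 0 -> f2_at v = 0 -> comm_at (solve_at v) = 0.
Proof.
move=> f1_0 f2_0; apply: comm_at_eq0 => i j i0 j0; rewrite comm_atE //.
case: i i0 => [[|[|[|[|[|i]]]]] // ?] _;
  case: j j0 => [[|[|[|[|[|j]]]]] // ?] _; rewrite /= /solve_at.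
- by rewrite /h11; ring.
- transitivity (v 41%N ^+ 2 * f2_at v); last by rewrite f2_0 mulr0.
  by rewrite /f2_at /h25 /h24 /h24a; ring.
- by rewrite /h13; ring.
- by rewrite /h15; ring.
- transitivity ((1 + v 41%N * v 51%N) * f2_at v); last by rewrite f2_0 mulr0.
  by rewrite /f2_at /h34 /h24 /h24b; ring.
- by rewrite /h11 /h34 /h34_rest /h23; ring.
- by rewrite /h12; ring.
- by rewrite /h14; ring.
- transitivity (- f1_at v); last by rewrite f1_0 oppr0.
  by rewrite /f1_at /h31c41; ring.
- by rewrite /h44; ring.
- by rewrite /h23 /h44h53; ring.
- by rewrite /h25 /h25_rest; ring.
- by rewrite /h53; ring.
- transitivity (v 51%N * f1_at v); last by rewrite f1_0 mulr0.
  by rewrite /f1_at /h53 /h31; ring.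
- by rewrite /h32; ring.
- by rewrite /h34 /h34_rest /h44h53; ring.
Qed.

(** * The substitution psi and its inverse on points *)

Section PsiAt.
Variables (R : comNzRingType) (v : nat -> R).
Local Notation c l := (v l%N).

Definition psi_at21 :=
  - c 41 ^+ 2 * c 43 * c 51 ^+ 2 - c 41 * c 45 * c 51 ^+ 3
  + c 41 ^+ 2 * c 42 * c 51 + c 41 ^+ 3 * c 52 + c 41 ^+ 2 * c 51 * c 54
  - c 45 * c 51 ^+ 2 + c 41 * c 51 * c 55 + c 41 * c 42 - c 41 * c 54
  - c 21 + c 43.

Definition psi_at33 := c 33 * c 41 * c 51 + c 35 * c 51 ^+ 2 + c 22.

Definition psi_at (l : nat) : R :=
  if l == 21%N then psi_at21
  else if l == 22%N then 2 * psi_at33 - c 33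
  else if l == 33%N then psi_at33
  else if l == 42%N then - c 42 - c 51 * psi_at21
  else c l.

(** As psi maps f1 to - c21, its inverse must map c21 to - f1; the other three
    formulas come from psi(2 c33 - c22) = c33, psi(c42 + c51 c21) = - c42 and
    c22 = psi(c33) - c33 c41 c51 - c35 c51^2. *)
Definition psi_inv_at (l : nat) : R :=
  if l == 21%N then - f1_at v
  else if l == 22%N then
    c 33 - (2 * c 33 - c 22) * c 41 * c 51 - c 35 * c 51 ^+ 2
  else if l == 33%N then 2 * c 33 - c 22
  else if l == 42%N then - c 42 - c 51 * c 21
  else c l.

Definition kill_at (ks : seq nat) (l : nat) : R := if l \in ks then 0 else c l.

End PsiAt.

Section PsiAtTheory.
Variables (R : comNzRingType) (v : nat -> R).

Lemma f1_at_psi_at : f1_at (psi_at v) = - v 21%N.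
Proof. by rewrite /f1_at /h31 /h31c41 /h44 /psi_at /= /psi_at21; ring. Qed.

Lemma psi_atK : {in CZ_labels, psi_inv_at (psi_at v) =1 v}.
Proof.
apply: in_CZ_labels; split=> //; rewrite /psi_inv_at /= ?f1_at_psi_at ?opprK //;
  by rewrite /psi_at /psi_at33 /=; ring.
Qed.

Lemma psi_inv_atK : {in CZ_labels, psi_at (psi_inv_at v) =1 v}.
Proof.
apply: in_CZ_labels; split=> //; rewrite /psi_at /= ?/psi_at21 ?/psi_at33;
  by rewrite /psi_inv_at /= ?/f1_at ?/h31 ?/h31c41 ?/h44; ring.
Qed.

End PsiAtTheory.

(** * Compatibility with ring morphisms *)

(** Taking [f] to be the identity, these lemmas also say that the constructions
    depend only on the coordinates of the point outside Z. *)
Section Naturality.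
Variables (R S : comNzRingType) (f : {rmorphism R -> S}).
Variables (u : nat -> R) (v : nat -> S).
Hypothesis fuv : {in CZ_labels, forall l, f (u l) = v l}.

Let rmE := (rmorphD f, rmorphN f, rmorphM f, rmorphXn f, rmorph1 f).
Let n44 : f (h44 u) = h44 v. Proof. by rewrite /h44 !rmE !fuv. Qed.
Let n31c41 : f (h31c41 u) = h31c41 v.
Proof. by rewrite /h31c41 !(n44, rmE) !fuv. Qed.
Let n31 : f (h31 u) = h31 v. Proof. by rewrite /h31 !(n31c41, rmE) !fuv. Qed.
Let n53 : f (h53 u) = h53 v. Proof. by rewrite /h53 !(n31, rmE) !fuv. Qed.
Let n44h53 : f (h44h53 u) = h44h53 v.
Proof. by rewrite /h44h53 !(n44, n53, rmE) !fuv. Qed.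
Let n23 : f (h23 u) = h23 v. Proof. by rewrite /h23 !(n44h53, rmE) !fuv. Qed.
Let n32 : f (h32 u) = h32 v. Proof. by rewrite /h32 !(n53, rmE) !fuv. Qed.
Let n25_rest : f (h25_rest u) = h25_rest v.
Proof. by rewrite /h25_rest !(n44, rmE) !fuv. Qed.
Let n34_rest : f (h34_rest u) = h34_rest v.
Proof. by rewrite /h34_rest !(n44h53, rmE) !fuv. Qed.
Let n24a : f (h24a u) = h24a v.
Proof. by rewrite /h24a !(n23, n25_rest, rmE) !fuv. Qed.
Let n24b : f (h24b u) = h24b v.
Proof. by rewrite /h24b !(n34_rest, n31, n32, rmE) !fuv. Qed.
Let n24 : f (h24 u) = h24 v.
Proof. by rewrite /h24 !(n24a, n24b, rmE) !fuv. Qed.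
Let n25 : f (h25 u) = h25 v.
Proof. by rewrite /h25 !(n24, n25_rest, rmE) !fuv. Qed.
Let n34 : f (h34 u) = h34 v.
Proof. by rewrite /h34 !(n24, n34_rest, rmE) !fuv. Qed.
Let n11 : f (h11 u) = h11 v.
Proof. by rewrite /h11 !(n23, n24, n31, rmE) !fuv. Qed.
Let n12 : f (h12 u) = h12 v.
Proof. by rewrite /h12 !(n31, n32, n34, n53, rmE) !fuv. Qed.
Let n13 : f (h13 u) = h13 v.
Proof. by rewrite /h13 !(n23, n24, n25, n53, rmE) !fuv. Qed.
Let n14 : f (h14 u) = h14 v.
Proof. by rewrite /h14 !(n24, n31, n32, n34, n44, rmE) !fuv. Qed.
Let n15 : f (h15 u) = h15 v.
Proof. by rewrite /h15 !(n23, n24, n25, n44, rmE) !fuv. Qed.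

Lemma solve_at_natural :
  {in C_labels, forall l, f (solve_at u l) = solve_at v l}.
Proof.
by move=> l; rewrite !inE; do !case/predU1P=> [->|]; try move/eqP->;
  rewrite /solve_at ?(n11, n12, n13, n14, n15, n23, n24, n25, n31, n32, n34,
    n44, n53) ?fuv.
Qed.

Lemma f1_at_natural : f (f1_at u) = f1_at v.
Proof. by rewrite /f1_at !(n31, n31c41, rmE) !fuv. Qed.

Lemma f2_at_natural : f (f2_at u) = f2_at v.
Proof. by rewrite /f2_at !(n24a, n24b, rmE) !fuv. Qed.

Lemma psi_at_natural : {in CZ_labels, forall l, f (psi_at u l) = psi_at v l}.
Proof.
by apply: in_CZ_labels; split;
  rewrite /psi_at /= /psi_at33 /psi_at21 ?(rmE, rmorph_nat) !fuv.
Qed.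

Lemma psi_inv_at_natural :
  {in CZ_labels, forall l, f (psi_inv_at u l) = psi_inv_at v l}.
Proof.
by apply: in_CZ_labels; split;
  rewrite /psi_inv_at /= ?(rmE, rmorph_nat, f1_at_natural) ?fuv.
Qed.

End Naturality.

(** The first four terms are the ones that psi turns into c22. *)
Lemma f2_at_split (R : comNzRingType) (v : nat -> R) :
  f2_at v = v 22%N * v 41%N * v 51%N - 2 * v 33%N * v 41%N * v 51%N
         - v 35%N * v 51%N ^+ 2 + v 33%N + f2_at (kill_at v [:: 22; 33; 35]%N).
Proof.
rewrite /f2_at /h24a /h24b /h34_rest /h25_rest /h32 /h23 /h44h53 /h53 /h31.
by rewrite /h31c41 /h44 /kill_at !inE /=; ring.
Qed.

(** Apart from c22, c33, c35, the indeterminates have images under psi that do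
    not involve these three, and c22 x - 2 c33 x - c35 c51^2 + c33, with
    x = c41 c51, is mapped to c22. *)
Lemma f2_at_psi_at (R : comNzRingType) (v : nat -> R) :
  f2_at (psi_at v) = v 22%N + f2_at (psi_at (kill_at v [:: 22%N])).
Proof.
rewrite [LHS]f2_at_split [f2_at (psi_at (kill_at _ _))]f2_at_split.
set w := kill_at v _; have <- : f2_at (kill_at (psi_at v) [:: 22; 33; 35]%N) =
    f2_at (kill_at (psi_at w) [:: 22; 33; 35]%N).
  by apply: (f2_at_natural (f := idfun)); apply: in_CZ_labels.
by rewrite /psi_at /psi_at33 /w /kill_at /=; ring.
Qed.

(** * The polynomials f1, f2 and the automorphism psi *)

Section PolynomialModel.
Variable K : fieldType.
Local Notation c := (cvar K).

Lemma f1_morph (R : comNzRingType) (f : {rmorphism {mpoly K[12]} -> R}) :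
  f (f1 K) = f1_at (f \o c).
Proof. by rewrite /f1 /f1_at /h31 /h31c41 /h44 /=; move: c => u; ring. Qed.

Lemma f2_morph (R : comNzRingType) (f : {rmorphism {mpoly K[12]} -> R}) :
  f (f2 K) = f2_at (f \o c).
Proof.
rewrite /f2 /f2_at /h24a /h24b /h34_rest /h25_rest /h32 /h23 /h44h53 /h53 /h31.
by rewrite /h31c41 /h44 /=; move: c => u; ring.
Qed.

Lemma psi_cvar : {in CZ_labels, forall l, psi K (c l) = psi_at c l}.
Proof.
move=> l Ll; rewrite [LHS]comp_mpoly_label //.
rewrite /psi_img /psi_at /psi_at21 /psi_at33; move: c => u.
by do !case: ifP => _ //; ring.
Qed.

Definition psi_inv : {lrmorphism {mpoly K[12]} -> {mpoly K[12]}} :=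
  comp_mpoly [tuple psi_inv_at c (tnth CZ_labels k) | k < 12].

Lemma psi_inv_cvar : {in CZ_labels, forall l, psi_inv (c l) = psi_inv_at c l}.
Proof. by move=> l Ll; apply: comp_mpoly_label. Qed.

Lemma psi_invK : cancel (psi K) psi_inv.
Proof.
have ext := labels_morph_ext (f := psi_inv \o psi K) (g := idfun).
apply: (ext CZ_labels) => // l Ll.
rewrite [LHS](congr1 psi_inv (psi_cvar Ll)) (psi_at_natural psi_inv_cvar) //.
exact: psi_inv_atK.
Qed.

Lemma psiK : cancel psi_inv (psi K).
Proof.
have ext := labels_morph_ext (f := psi K \o psi_inv) (g := idfun).
apply: (ext CZ_labels) => // l Ll.
rewrite [LHS](congr1 (psi K) (psi_inv_cvar Ll)).
by rewrite (psi_inv_at_natural psi_cvar) //; apply: psi_atK.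
Qed.

Lemma psi_f1 : psi K (f1 K) = - c 21.
Proof.
rewrite f1_morph -f1_at_psi_at.
exact: (f1_at_natural (f := idfun)) psi_cvar.
Qed.

Lemma psi_f2 : psi K (f2 K) = f2_at (psi_at c).
Proof. by rewrite f2_morph; apply: (f2_at_natural (f := idfun)) psi_cvar. Qed.

Definition kill (ks : seq nat) : {lrmorphism {mpoly K[12]} -> {mpoly K[12]}} :=
  comp_mpoly [tuple kill_at c ks (tnth CZ_labels k) | k < 12].

Lemma kill_cvar ks : {in CZ_labels, forall l, kill ks (c l) = kill_at c ks l}.
Proof. by move=> l Ll; apply: comp_mpoly_label. Qed.

Lemma f2_at_psi_at_natural (R S : comNzRingType) (f : {rmorphism R -> S})
    (u : nat -> R) (v : nat -> S) :
  {in CZ_labels, forall l, f (u l) = v l} ->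
  f (f2_at (psi_at u)) = f2_at (psi_at v).
Proof. by move=> fuv; apply/f2_at_natural/psi_at_natural. Qed.

Lemma fhat2E : fhat2 K = f2_at (psi_at (kill_at c [:: 21%N])).
Proof.
have -> : fhat2 K = kill [:: 21%N] (psi K (f2 K)).
  congr comp_mpoly; apply: eq_from_tnth => k; rewrite !tnth_mktuple.
  by rewrite /kill_at inE.
by rewrite psi_f2; apply: f2_at_psi_at_natural (kill_cvar _).
Qed.

(** Both <psi(f1), psi(f2)> and <fhat1, fhat2> contain c21, so this identifies
    their second generators. *)
Lemma psi_f2_modulo_c21 (R : comNzRingType)
    (f : {rmorphism {mpoly K[12]} -> R}) :
  f (c 21) = 0 -> f (psi K (f2 K)) = f (fhat2 K).
Proof.
move=> c21_0; transitivity (f2_at (psi_at (f \o c))).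
  by rewrite psi_f2; apply: f2_at_psi_at_natural.
rewrite fhat2E; apply/esym/f2_at_psi_at_natural => l _.
rewrite /kill_at inE [RHS]/=; case: eqP => [-> | _ //].
by rewrite rmorph0 c21_0.
Qed.

End PolynomialModel.

(** * The separating re-embedding Phi *)

Lemma comm_at_eq_in (R : comNzRingType) (u v : nat -> R) :
  {in C_labels, u =1 v} -> comm_at u = comm_at v.
Proof.
move=> uv; have eqM r : r \in [:: 1; 2]%N -> mulmx_at u r = mulmx_at v r.
  rewrite !inE => /orP[] /eqP-> {r}; apply/matrixP => i j; rewrite !mxE;
  case: i j => [[|[|[|[|[|i]]]]] // ?] [[|[|[|[|[|j]]]]] // ?] //=;
  exact: uv.
by rewrite /comm_at !eqM.
Qed.

Section BorderBasisScheme.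
Variable K : fieldType.
Local Notation c := (cvar K).

Definition Cvar (l : nat) : {mpoly K[25]} := 'X_(pos C_labels l).

(** The functor of points of the border basis scheme: a morphism out of K[C]
    factors through B_O exactly when the multiplication matrices at the image
    point commute. *)
Lemma border_gens_comm_at (R : comNzRingType)
    (f : {rmorphism {mpoly K[25]} -> R}) :
  {in border_gens K, forall g, f g = 0} <-> comm_at (f \o Cvar) = 0.
Proof.
have fM r i j : f (gen_mulmx K r i j) = mulmx_at (f \o Cvar) r i j.
  rewrite !mxE; move: (mul_var _ _) => t /=.
  by case: (t \in order_terms); first exact: rmorph_nat.
have fMM r s i j : f ((gen_mulmx K r *m gen_mulmx K s) i j)
    = (mulmx_at (f \o Cvar) r *m mulmx_at (f \o Cvar) s) i j.
  rewrite [RHS]mxE.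
  transitivity (f (\sum_k gen_mulmx K r i k * gen_mulmx K s k j)).
    by congr (f _); rewrite mxE.
  rewrite rmorph_sum; apply: eq_bigr => k _; rewrite [LHS]rmorphM.
  by congr (_ * _); apply: fM.
have subE (T : zmodType) (A B : 'M[T]_5) i j : (A - B) i j = A i j - B i j.
  by rewrite !mxE.
have fN i j : f (commutator_mx K i j) = comm_at (f \o Cvar) i j.
  rewrite [RHS]subE; transitivity (f ((gen_mulmx K 1 *m gen_mulmx K 2) i j
    - (gen_mulmx K 2 *m gen_mulmx K 1) i j)); first by congr (f _); apply: subE.
  by rewrite rmorphB; congr (_ - _); apply: fMM.
split=> [f0 | N0 _ /allpairsP[[i j] [_ _ ->]]]; last by rewrite fN N0 mxE.
apply/matrixP => i j; rewrite -fN [RHS]mxE f0 //.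
by apply/allpairsP; exists (i, j); rewrite !mem_enum.
Qed.

End BorderBasisScheme.

Section MainPieces.
Variable K : fieldType.
Local Notation c := (cvar K).
Local Notation inclZ := (incl K CZ_in_C).

Lemma perm_Z_CZ : perm_eq (Z_in_C ++ CZ_in_C) (enum 'I_25).
Proof. by rewrite /= !mktuple_pos -map_cat; apply: perm_pos. Qed.

Lemma perm_c21_c22_Chat : perm_eq (c21_c22 ++ Chat_in_CZ) (enum 'I_12).
Proof.
rewrite /= mktuple_pos.
exact: (@perm_pos 11 CZ_labels ([:: 21; 22]%N ++ Chat_labels)).
Qed.

Lemma incl_cvar l : l \in CZ_labels -> inclZ (c l) = Cvar K l.
Proof. by move=> Ll; rewrite inclX tnth_mktuple tnth_pos. Qed.

Lemma residue_ideal_gen (R : comAlgType K) (gs : seq R)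
    (gs1 : 1 \notin ideal_span gs) :
  {in gs, forall g, residue_class (ideal_gen gs1) g = 0}.
Proof. by move=> g gsg; apply/residue_class_eq0/ideal_span_mem. Qed.

Definition hZ : 13.-tuple {mpoly K[12]} :=
  [tuple solve_at c (tnth Z_labels i) | i < 13].

Definition pZ : 13.-tuple {mpoly K[25]} :=
  [tuple 'X_(tnth Z_in_C i) - inclZ (tnth hZ i) | i < 13].

Local Notation resB := (residue_class (I_BO K)).

Lemma border_relations :
  [/\ forall l, l \in C_labels -> resB (Cvar K l) = solve_at (resB \o Cvar K) l,
      f1_at (resB \o Cvar K) = 0 & f2_at (resB \o Cvar K) = 0].
Proof.
have N0 : comm_at (resB \o Cvar K) = 0.
  apply/border_gens_comm_at; exact: residue_ideal_gen.
by have [solE f1_0 f2_0] := comm_at_eq0_solve N0; split=> // l _; rewrite -solE.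
Qed.

Lemma pZ_in_I i : tnth pZ i \in I_BO K.
Proof.
have [solE _ _] := border_relations.
rewrite tnth_mktuple; apply/residue_class_eq; rewrite !tnth_mktuple.
set l := tnth Z_labels i.
have ZC : {subset Z_labels <= C_labels} by apply/allP.
have Cl : l \in C_labels by apply/ZC/mem_tnth.
rewrite [LHS]solE //; apply/esym.
apply: (solve_at_natural (f := resB \o inclZ)) => // k Lk.
by rewrite /= incl_cvar.
Qed.

Lemma eliminate_Cvar l :
  l \in C_labels -> eliminate Z_in_C CZ_in_C hZ (Cvar K l) = solve_at c l.
Proof.
have ZCZ : {subset C_labels <= Z_labels ++ CZ_labels} by apply/allP.
move=> /ZCZ; rewrite mem_cat => /orP[] Ll.
  have -> : Cvar K l = 'X_(tnth Z_in_C (pos Z_labels l)).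
    by rewrite tnth_mktuple tnth_pos.
  by rewrite (eliminate_z perm_Z_CZ) tnth_mktuple tnth_pos.
rewrite -incl_cvar // (eliminateK perm_Z_CZ).
by move: l Ll; apply: in_CZ_labels.
Qed.

(** The elimination ideal is generated by f1 and f2.  They lie in it since they
    vanish at the universal point over B_O; conversely, over the residue class ring
    modulo f1 and f2 the values [solve_at] of the eliminated indeterminates
    define a point of the scheme, so the border relations vanish there. *)
Lemma residue_f_ker (q : {mpoly K[12]}) :
  residue_class (I_f K) q = 0 <-> inclZ q \in I_BO K.
Proof.
split=> [/residue_class_eq0 qI | qI].
  have [_ f1_0 f2_0] := border_relations.
  have resC : {in CZ_labels, forall l,
      (resB \o inclZ) (c l) = (resB \o Cvar K) l}.
    by move=> l Ll; rewrite /= incl_cvar.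
  apply/residue_class_eq0; apply: (ideal_span_rmorph0 (f := resB \o inclZ)) qI.
  move=> g; rewrite !inE => /orP[] /eqP->.
    by rewrite f1_morph -f1_0; apply: (f1_at_natural (f := idfun)) resC.
  by rewrite f2_morph -f2_0; apply: (f2_at_natural (f := idfun)) resC.
pose resf := residue_class (I_f K).
pose elim := eliminate Z_in_C CZ_in_C hZ.
have f0 : {in [:: f1 K; f2 K], forall g, resf g = 0}.
  exact: residue_ideal_gen.
have comm0 : comm_at ((resf \o elim) \o Cvar K) = 0.
  rewrite -(@comm_at_solve _ (resf \o c)).
  - apply: comm_at_eq_in => l Cl; rewrite /= eliminate_Cvar //.
    exact: solve_at_natural.
  - by rewrite -f1_morph; apply: f0; rewrite inE eqxx.
  - by rewrite -f2_morph; apply: f0; rewrite !inE eqxx orbT.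
rewrite -[q](eliminateK perm_Z_CZ hZ).
apply: (ideal_span_rmorph0 (f := resf \o elim)) qI.
exact/border_gens_comm_at.
Qed.

Lemma Phi_exists :
  exists Phi : {lrmorphism B_O K -> {ideal_quot I_f K}},
    separating_reembedding Z_in_C CZ_in_C pZ (residue_class (I_f K)) Phi.
Proof.
apply: (separating_reembedding_exists perm_Z_CZ (h := hZ)) => [i|||].
- by rewrite tnth_mktuple.
- exact: pZ_in_I.
- exact: residue_class_surj.
- exact: residue_f_ker.
Qed.

(** * The isomorphism Psi and the equality of the two ideals *)

Local Notation resP := (residue_class (I_psi_f K)).

Lemma Psi_exists :
  exists Psi : {lrmorphism {ideal_quot I_f K} -> {ideal_quot I_psi_f K}},
    (forall q, Psi (residue_class (I_f K) q) = resP (psi K q)) /\ bijective Psi.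
Proof.
apply: (quot_isomorphism (g := resP \o psi K)) => [q|t]; last first.
  by have [q <-] := residue_class_surj t; exists (psi_inv K q); rewrite /= psiK.
split=> [/residue_class_eq0 qI | qI].
  apply/residue_class_eq0; rewrite -(psi_invK q).
  apply: (ideal_span_rmorph0 (f := residue_class (I_f K) \o psi_inv K)) qI.
  move=> g; rewrite !inE => /orP[] /eqP-> /=; rewrite psi_invK;
  by apply: residue_ideal_gen; rewrite !inE eqxx ?orbT.
apply: (ideal_span_rmorph0 (f := resP \o psi K)) qI.
by move=> g; rewrite !inE => /orP[] /eqP-> /=; apply: residue_ideal_gen;
  rewrite !inE eqxx ?orbT.
Qed.

Local Notation resH := (residue_class (I_fhat K)).

Lemma psi_f_fhat_ideal : (I_psi_f K : {pred {mpoly K[12]}}) =i I_fhat K.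
Proof.
move=> q; apply/idP/idP => qI; apply/residue_class_eq0.
  have c21_0 : resH (c 21) = 0.
    by apply: (residue_ideal_gen (fhat_proper K)); rewrite inE eqxx.
  apply: (ideal_span_rmorph0 (f := resH)) qI => g.
  rewrite !inE => /orP[] /eqP->.
    by rewrite psi_f1 rmorphN; apply/eqP; rewrite oppr_eq0; apply/eqP.
  rewrite psi_f2_modulo_c21 //; apply: (residue_ideal_gen (fhat_proper K)).
  by rewrite !inE eqxx orbT.
have c21_0 : resP (c 21) = 0.
  apply/eqP; rewrite -oppr_eq0 -rmorphN -psi_f1; apply/eqP.
  by apply: (residue_ideal_gen (psi_f_proper K)); rewrite inE eqxx.
apply: (ideal_span_rmorph0 (f := resP)) qI => g.
rewrite !inE => /orP[] /eqP-> //.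
rewrite -psi_f2_modulo_c21 //; apply: (residue_ideal_gen (psi_f_proper K)).
by rewrite !inE eqxx orbT.
Qed.

Lemma E_exists :
  exists E : {lrmorphism {ideal_quot I_psi_f K} -> {ideal_quot I_fhat K}},
    (forall q, E (resP q) = resH q) /\ bijective E.
Proof.
have ker q : resH q = 0 <-> q \in I_psi_f K.
  by rewrite psi_f_fhat_ideal; apply: residue_class_eq0.
exact: quot_isomorphism ker (@residue_class_surj _ _ _).
Qed.

End MainPieces.

(** * Separating tuples in c21, c22 and the re-embedding Theta *)

Section Fhat.
Variable K : fieldType.
Local Notation c := (cvar K).
Local Notation inclH := (incl K Chat_in_CZ).
Local Notation perm_hat := perm_c21_c22_Chat.

(** The first polynomial is a monomial up to sign, so it suffices to make c22
    larger than the terms of the second one, which may involve c21. *)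
Lemma psi_f_separating :
  separating c21_c22 [tuple psi K (f1 K); psi K (f2 K)].
Proof.
split; first exact: uniq_separated perm_hat.
exists (elim_le (pred1 (pos CZ_labels 22))); first exact: elim_le_term_ordering.
case=> [[|[|i]] // lti]; rewrite !(tnth_nth 0) /=.
  by rewrite psi_f1; apply: leading_term_oppX.
rewrite psi_f2 f2_at_psi_at -[X in _ + X]opprK; apply: leading_term_subr => //=.
apply: avoidsN; rewrite -(f2_at_psi_at_natural (kill_cvar K _)).
apply: avoids_comp_mpoly => k; rewrite tnth_mktuple /kill_at inE.
case: eqP => [_|k'22]; first exact: avoids0.
apply: avoidsX; apply/negP => /eqP/(congr1 (tnth CZ_labels)).
by rewrite !tnth_pos ?mem_tnth.
Qed.

Definition forget21_22 : {lrmorphism {mpoly K[12]} -> {mpoly K[10]}} :=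
  eliminate c21_c22 Chat_in_CZ [tuple 0; 0].

Lemma incl_forget21_22 : {in CZ_labels, forall l,
  inclH (forget21_22 (c l)) = kill_at c [:: 21; 22]%N l}.
Proof.
have z1 : forget21_22 (c 21) = 0 := eliminate_z perm_hat _ ord0.
have z2 : forget21_22 (c 22) = 0 := eliminate_z perm_hat _ ord_max.
have y l : l \in Chat_labels -> inclH (forget21_22 (c l)) = c l.
  move=> Ll; have cE : c l = inclH 'X_(pos Chat_labels l).
    by rewrite inclX tnth_mktuple tnth_pos.
  by rewrite {1}cE /forget21_22 (eliminateK perm_hat).
have CZ_hat : {subset CZ_labels <= [:: 21; 22]%N ++ Chat_labels} by apply/allP.
move=> l /CZ_hat; rewrite mem_cat /kill_at; case: ifP => [|_]; last exact: y.
rewrite !inE => /orP[] /eqP-> _.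
  exact: etrans (congr1 inclH z1) (rmorph0 _).
exact: etrans (congr1 inclH z2) (rmorph0 _).
Qed.

(** The image of [fhat2 K] under c21, c22 |-> 0 is its part free of c22. *)
Definition hhat : 2.-tuple {mpoly K[10]} :=
  [tuple 0; - forget21_22 (fhat2 K)].

Lemma fhatE i :
  tnth [tuple fhat1 K; fhat2 K] i
  = 'X_(tnth c21_c22 i) - inclH (tnth hhat i).
Proof.
case: i => [[|[|i]] // lti]; rewrite !(tnth_nth 0) /=.
  by rewrite rmorph0 subr0.
have kill2 : kill_at (kill_at c [:: 21]) [:: 22] =1 kill_at c [:: 21; 22].
  by move=> l; rewrite /kill_at !inE; do 2!case: eqP.
have -> : inclH (- forget21_22 (fhat2 K))
    = - f2_at (psi_at (kill_at c [:: 21; 22]%N)).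
  rewrite rmorphN fhat2E; congr (- _).
  apply: (f2_at_psi_at_natural (f := inclH \o forget21_22)) => l Ll.
  rewrite /kill_at inE; case: eqP => [-> | /eqP /negPf l'21].
    by rewrite !rmorph0.
  by rewrite [LHS]incl_forget21_22 // /kill_at !inE l'21.
rewrite opprK fhat2E [LHS]f2_at_psi_at.
apply: (congr2 +%R); first by [].
by apply: (f2_at_psi_at_natural (f := idfun)) => l _; apply: kill2.
Qed.

Lemma Theta_exists :
  exists Theta : {lrmorphism {ideal_quot I_fhat K} -> {mpoly K[10]}},
    separating_reembedding c21_c22 Chat_in_CZ [tuple fhat1 K; fhat2 K]
      idfun Theta.
Proof.
have fhatI i : tnth [tuple fhat1 K; fhat2 K] i \in I_fhat K.
  exact/ideal_span_mem/mem_tnth.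
apply: (separating_reembedding_exists perm_hat fhatE fhatI) => [x|q].
  by exists x.
split=> [q0 | qI]; first by rewrite (q0 : q = 0) rmorph0 rpred0.
rewrite -[LHS](eliminateK perm_hat hhat).
apply: (ideal_span_rmorph0 (f := eliminate c21_c22 Chat_in_CZ hhat)) qI.
have -> : [:: fhat1 K; fhat2 K] = [tuple fhat1 K; fhat2 K] :> seq _ by [].
move=> g /tnthP[i ->]; rewrite fhatE rmorphB.
apply/eqP; rewrite subr_eq0; apply/eqP.
exact: etrans (eliminate_z perm_hat _ _) (esym (eliminateK perm_hat _ _)).
Qed.

End Fhat.

(** * The L-shape border basis scheme is an affine space *)

Theorem proposition4p4 (K : fieldType) (perfK : perfect_field K) :
  exists (Phi : {lrmorphism B_O K -> {ideal_quot I_f K}})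
         (Psi : {lrmorphism {ideal_quot I_f K} -> {ideal_quot I_psi_f K}})
         (E : {lrmorphism {ideal_quot I_psi_f K} -> {ideal_quot I_fhat K}})
         (Theta : {lrmorphism {ideal_quot I_fhat K} -> {mpoly K[10]}}),
  [/\ (* Phi is the separating re-embedding for Z *)
      exists p : 13.-tuple {mpoly K[25]},
        separating_reembedding Z_in_C CZ_in_C p (residue_class (I_f K)) Phi,
      (* (1) *)
      [/\ bijective (psi K),
          (forall q, Psi (residue_class (I_f K) q)
                     = residue_class (I_psi_f K) (psi K q)),
          bijective Psi,
          psi K (f1 K) = - cvar K 21
        & separating c21_c22 [tuple psi K (f1 K); psi K (f2 K)]],
      (* (2); E is the identification of the residue class rings modulo
         the two equal ideals *)
      [/\ (I_psi_f K : {pred {mpoly K[12]}}) =i I_fhat K,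
          (forall q, E (residue_class (I_psi_f K) q)
                     = residue_class (I_fhat K) q),
          coherently_separating c21_c22 [tuple fhat1 K; fhat2 K]
        & separating_reembedding c21_c22 Chat_in_CZ [tuple fhat1 K; fhat2 K]
            idfun Theta]
    & (* (3) *)
      bijective (Theta \o E \o Psi \o Phi) /\
      Spec_isomorphic (B_O K) {mpoly K[10]}].

Proof.
have [Phi Phi_sep] := Phi_exists K.
have [Psi [PsiE Psi_bij]] := Psi_exists K.
have [E [EE E_bij]] := E_exists K.
have [Theta Theta_sep] := Theta_exists K.
have [_ _ _ _ Phi_bij] := Phi_sep.
have [_ [fhat_sep _] _ _ Theta_bij] := Theta_sep.
have all_bij : bijective (Theta \o E \o Psi \o Phi).
  exact/bij_comp/Phi_bij/bij_comp/Psi_bij/bij_comp/E_bij.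
exists Phi, Psi, E, Theta; split.
- by exists (pZ K).
- split=> //; first by exists (psi_inv K); [apply: psi_invK | apply: psiK].
    exact: psi_f1.
  exact: psi_f_separating.
- by split; [exact: psi_f_fhat_ideal | | |].
- split=> //.
  exact: (@bijective_Spec_isomorphic _ _ _ (Theta \o E \o Psi \o Phi)).
Qed.
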